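(* The set of periodic directions of the Mucube $M$ is dense in the set of all directions (the circle $S^1$; equivalently, the set of slopes of periodic directions is dense in $\mathbb{R}\cup\{\infty\}$).
   Context: The Mucube: let $C\subset\mathbb{R}^2$ be the closure of $\{(x,y):\lfloor x-1/2\rfloor\text{ and }\lfloor y-1/2\rfloor\text{ have opposite parity}\}$ and $M=\{(x,y,z)\in\mathbb{R}^3:(x,y)\in C,\ (x,z)\in C,\ (y,z)\in C\}$. $M$ is a surface tiled by closed unit square faces with vertices in $(\tfrac12+\mathbb{Z})^3$, six squares meeting at each vertex. With its intrinsic metric $M$ is flat away from the vertices, which are cone points of angle $3\pi$. Away from the cone points there is an atlas of isometric charts to $\mathbb{R}^2$ with transition maps $v\mapsto\pm v+c$, sending edges of squares to horizontal or vertical segments (equivalently, identify one face with $[0,1]^2$ and extend by parallel transport); the direction and slope of a straight-line trajectory are measured in these charts (directions up to sign). A direction is periodic if the straight-line trajectories of $M$ in that direction that do not meet cone points are periodic (closed). *)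

(* Defs.v *)
From HB Require Import structures.
From mathcomp Require Import all_boot all_order all_algebra.
From mathcomp Require Import all_classical all_reals all_analysis.
Set Implicit Arguments.
Unset Strict Implicit.
Unset Printing Implicit Defensive.
Import Order.TTheory GRing.Theory Num.Theory.
Import numFieldNormedType.Exports.
Local Open Scope classical_set_scope.
Local Open Scope ring_scope.

(* The library norm on 'rV[R]_n is the sup norm, so the Euclidean norm is
   introduced here; both induce the same topology. *)
Definition enorm (R : realType) (n : nat) (v : 'rV[R]_n) : R :=
  Num.sqrt (\sum_(i < n) v 0 i ^+ 2).

Definition circle (R : realType) : set 'rV[R]_2 := [set u | enorm u = 1].

Definition checkerboard (R : realType) : set (R * R) :=
  closure [set v : R * R | ~~ (2 %| Num.floor (v.1 - 2^-1) - Num.floor (v.2 - 2^-1))%Z].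

Definition mucube (R : realType) : set 'rV[R]_3 :=
  [set p | forall i j : 'I_3, (i < j)%N -> checkerboard (p 0 i, p 0 j)].

(* The points of (1/2 + Z)^3; all of them lie on the Mucube, and they are
   exactly its vertices, i.e. its cone points. *)
Definition cone_point (R : realType) (p : 'rV[R]_3) : Prop :=
  forall i : 'I_3, p 0 i - 2^-1 \is a Num.int.

Definition unit_square (R : realType) (i : 'I_3) (a : 'rV[R]_3) :
    set 'rV[R]_3 :=
  [set p | p 0 i = a 0 i /\
           forall j : 'I_3, j != i -> a 0 j <= p 0 j <= a 0 j + 1].

Definition unit_edge (R : realType) (i : 'I_3) (a : 'rV[R]_3) :
    set 'rV[R]_3 :=
  [set p | a 0 i <= p 0 i <= a 0 i + 1 /\
           forall j : 'I_3, j != i -> p 0 j = a 0 j].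

Definition face (R : realType) (F : set 'rV[R]_3) : Prop :=
  exists (i : 'I_3) (a : 'rV[R]_3),
    [/\ cone_point a, F = unit_square i a & F `<=` @mucube R].

Definition adjacent (R : realType) (F G : set 'rV[R]_3) : Prop :=
  [/\ face F, face G &
      exists (i : 'I_3) (a : 'rV[R]_3),
        cone_point a /\ F `&` G = unit_edge i a].

Definition isometric_on (R : realType) (F : set 'rV[R]_3)
    (phi : 'rV[R]_3 -> 'rV[R]_2) : Prop :=
  forall p q, F p -> F q -> enorm (phi p - phi q) = enorm (p - q).

(* Isometric charts for the intrinsic metric on the union of two adjacent
   faces: injectivity forces the images of the two faces to lie on opposite
   sides of the image of the common edge, so that phi unfolds the right angle
   between the faces.  The values of phi outside F and G are irrelevant. *)
Definition unfolding (R : realType) (F G : set 'rV[R]_3)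
    (phi : 'rV[R]_3 -> 'rV[R]_2) : Prop :=
  [/\ adjacent F G, isometric_on F phi, isometric_on G phi &
      forall p q, (F `|` G) p -> (F `|` G) q -> phi p = phi q -> p = q].

Definition unit_square_chart (R : realType) (F : set 'rV[R]_3)
    (phi : 'rV[R]_3 -> 'rV[R]_2) : Prop :=
  [/\ face F, isometric_on F phi &
      phi @` F = [set v | forall j : 'I_2, 0 <= v 0 j <= 1]].

(* The charts of faces obtained from the chart phi0 of F0 by parallel transport
   along chains of adjacent faces.  Edges go to horizontal or vertical segments
   because they do so under phi0.  Two charts of the same face obtained along
   different chains differ by a map v |-> +/- v + c. *)
Inductive transported (R : realType) (F0 : set 'rV[R]_3)
    (phi0 : 'rV[R]_3 -> 'rV[R]_2) :
    set 'rV[R]_3 -> ('rV[R]_3 -> 'rV[R]_2) -> Prop :=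
  | transported_base : transported F0 phi0 F0 phi0
  | transported_step F G phi psi :
      transported F0 phi0 F phi -> unfolding F G psi -> (forall p, F p -> psi p = phi p) ->
      transported F0 phi0 G psi.

Definition atlas_chart (R : realType) (F0 : set 'rV[R]_3)
    (phi0 : 'rV[R]_3 -> 'rV[R]_2) (F G : set 'rV[R]_3)
    (psi : 'rV[R]_3 -> 'rV[R]_2) : Prop :=
  unfolding F G psi /\ transported F0 phi0 F psi.

(* Complete unit-speed straight-line trajectories avoiding the cone points, in
   the direction u up to sign.  Every point of the Mucube other than a cone
   point is interior to the union of some two adjacent faces. *)
Definition trajectory (R : realType) (F0 : set 'rV[R]_3)
    (phi0 : 'rV[R]_3 -> 'rV[R]_2) (u : 'rV[R]_2)
    (gamma : R -> 'rV[R]_3) : Prop :=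
  forall t : R, ~ cone_point (gamma t) /\
    exists (F G : set 'rV[R]_3) (psi : 'rV[R]_3 -> 'rV[R]_2) (b : bool),
      atlas_chart F0 phi0 F G psi /\
      \forall s \near t, (F `|` G) (gamma s) /\
        psi (gamma s) = psi (gamma t) + ((-1) ^+ b * (s - t)) *: u.

Definition closed_trajectory (R : realType) (gamma : R -> 'rV[R]_3) : Prop :=
  exists2 T : R, 0 < T & forall t : R, gamma (t + T) = gamma t.

Definition periodic_directions (R : realType) (F0 : set 'rV[R]_3)
    (phi0 : 'rV[R]_3 -> 'rV[R]_2) : set 'rV[R]_2 :=
  [set u | circle u /\
    forall gamma : R -> 'rV[R]_3,
      trajectory F0 phi0 u gamma -> closed_trajectory gamma].

(* Main.v *)
(* A trajectory that leaves a square through its right (upper) edge changes the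
   frame of the square by a fixed rotation [r] (resp. [t]) of order 4 of the
   ambient space.  A trajectory of slope p/q therefore closes up as soon as
   the primitive word of slope p/q in the free group on two letters, evaluated at
   (r, t), is an isometry of finite order: running Euclid's algorithm on (q, p)
   replaces (r, t) by another basis (x, y) of the free group, and the word by x.
   It remains to see that every positive word in the two moves (x, y) |-> (x, xy)
   and (x, y) |-> (xy, y) extends to one for which x has finite order.  Up to
   conjugacy, the pairs reached that have the linear parts of (r, t) depend on two
   integers a and c, with c odd; four loops of moves act on them by
   c |-> c - 4a, c |-> c + 4a, (a, c) |-> (c - a, -c) and (a, c) |-> (-a - c, -c),
   so that Euclid's algorithm leads to a = 0, where x is a rotation of order 4. *)
Require Import Defs.
From HB Require Import structures.
From mathcomp Require Import all_boot all_order all_algebra.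
From mathcomp Require Import all_classical all_reals all_analysis.
From mathcomp Require Import ring lra zify.
Set Implicit Arguments.
Unset Strict Implicit.
Unset Printing Implicit Defensive.
Import Order.TTheory GRing.Theory Num.Theory.
Import numFieldNormedType.Exports.
Local Open Scope classical_set_scope.
Local Open Scope ring_scope.

(** The surface is infinite: with a rational slope a trajectory closes only up to an isometry of
    space, a power of which is a translation, and finite order is what forbids the drift. In
    [model], x and y are quarter-turn screw motions about perpendicular axes at distance |c|, each
    with displacement 2|a| along its axis; hence the role of a = 0. Density: the slopes of all
    extensions of a positive word lie in one cone, and a long run of equal letters makes it narrow;
    a word of finite order found anywhere beyond has nearly the prescribed slope. The geometric
    obstacle is that a trajectory is known only through local charts. Frames are normalised by a
    parity condition so that crossing an edge is a fixed matrix and, when the two speeds along the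
    edges differ, the germ of a trajectory before an instant determines its frame, hence its germ
    afterwards. This uniqueness justifies the coding and, applied also to the reversed trajectory,
    turns eventual periodicity into a true period. Slopes 1 and -1 are avoided for this reason. *)

(* The cutting sequence of a line of slope [p / q] as a two-interval exchange:
   the real coordinate locates the line in the current square, [x] and [y]
   update the frame of the square when the line leaves it rightwards, upwards. *)
Definition cut_step (R : realDomainType) (X : Type) (q p : R) (x y : X -> X)
    (z : R * X) : R * X :=
  if z.1 < q then (z.1 + p, x z.2) else (z.1 - q, y z.2).

(** The preperiod absorbs the steps spent before the orbit enters the smaller domain of an induction
    step. *)
Definition eventually_periodic (R : realDomainType) (X : Type) (q p : R)
    (x y : X -> X) :=
  forall z : R * X, 0 <= z.1 < q + p -> exists m n : nat,
    iter (m + n.+1) (cut_step q p x y) z = iter m (cut_step q p x y) z.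

(** * Induction on two-interval exchanges *)

Section Induction.
Variables (R : realDomainType) (X : Type).
Implicit Types (q p d : R) (x y : X -> X) (g : X).

Lemma cut_step_dom q p x y z : 0 <= q -> 0 <= p ->
  0 <= z.1 < q + p -> 0 <= (cut_step q p x y z).1 < q + p.
Proof. by rewrite /cut_step => q0 p0 /andP[z0 z1]; case: ltP => /= h; apply/andP; split; lra. Qed.

Lemma iter_accelerate (Y : Type) (D : Y -> Prop) (f f' : Y -> Y) (z : Y) n :
  (forall z, D z -> D (f' z)) ->
  (forall z, D z -> exists m, f' z = iter m.+1 f z) ->
  D z -> exists m, (n <= m)%N /\ iter n f' z = iter m f z.
Proof.
move=> stab acc Dz; suff [Dn [m [nm E]]] :
    D (iter n f' z) /\ exists m, (n <= m)%N /\ iter n f' z = iter m f z.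
  by exists m.
elim: n => [|n [Dn [m [nm E]]]]; first by split=> //; exists 0%N.
have [k Ek] := acc _ Dn; split; first exact: stab.
exists (k.+1 + m)%N; split; first by lia.
by rewrite iterS Ek E iterD.
Qed.

Lemma eventually_periodic_accelerate q p q' p' x y x' y' :
  (forall z, 0 <= z.1 < q + p -> exists m,
     0 <= (iter m (cut_step q p x y) z).1 < q' + p') ->
  (forall z, 0 <= z.1 < q' + p' -> exists m,
     cut_step q' p' x' y' z = iter m.+1 (cut_step q p x y) z) ->
  0 <= q' -> 0 <= p' ->
  eventually_periodic q' p' x' y' -> eventually_periodic q p x y.
Proof.
move=> enter acc q0 p0 per z zD; have [m0] := enter _ zD.
set z1 := iter m0 _ z => z1D; have [m [n E]] := per _ z1D.
have stab w : 0 <= w.1 < q' + p' -> 0 <= (cut_step q' p' x' y' w).1 < q' + p'.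
  exact: cut_step_dom.
have [m1 [_ E1]] := iter_accelerate m stab acc z1D.
have z2D : 0 <= (iter m (cut_step q' p' x' y') z1).1 < q' + p'.
  by elim: (m) => //= k /stab.
have [n1 [n1n E2]] := iter_accelerate n.+1 stab acc z2D.
exists (m1 + m0)%N, n1.-1; rewrite prednK; last by apply: leq_trans n1n.
rewrite addnC iterD; rewrite iterD -/z1 -E1 -E2 -iterD addnC E //.
Qed.

(** One step of Rauzy induction: the first return to [0, q + p) is a right move below q, and a right
    move followed by an up move otherwise. *)
Lemma eventually_periodic_T q p x y : 0 <= q -> 0 <= p ->
  eventually_periodic q p x (y \o x) -> eventually_periodic (q + p) p x y.
Proof.
move=> q0 p0; apply: eventually_periodic_accelerate => // -[d g] /= /andP[d0 d1].
  case: (ltP d (q + p)) => h; first by exists 0%N => /=; lra.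
  by exists 1%N; rewrite /= /cut_step /= ltNge h /=; lra.
case: (ltP d q) => h.
  by exists 0%N; rewrite /= /cut_step /= h ifT //; lra.
exists 1%N; rewrite /= /cut_step /= ltNge h /= d1 /= ifF; last by apply/negbTE; lra.
by congr pair; ring.
Qed.

Lemma eventually_periodic_U q p x y : 0 <= q -> 0 <= p ->
  eventually_periodic q p (y \o x) y -> eventually_periodic q (p + q) x y.
Proof.
move=> q0 p0; apply: eventually_periodic_accelerate => // -[d g] /= /andP[d0 d1].
  case: (ltP d (q + p)) => h; first by exists 0%N => /=; lra.
  by exists 1%N; rewrite /= /cut_step /= ifF /=; [lra | apply/negbTE; lra].
case: (ltP d q) => h.
  exists 1%N; rewrite /= /cut_step /= h /= ifF; last by apply/negbTE; lra.
  by congr pair; ring.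
by exists 0%N; rewrite /= /cut_step /= ltNge h.
Qed.

End Induction.

(** * Nielsen moves on pairs, up to conjugacy *)

Section Words.
Variable A : nzRingType.
Implicit Types (w : seq bool) (P : A * A).

(* The Nielsen move that accompanies the shear [q, p |-> q + p, p] of the
   direction ([b = true]) or [q, p |-> q, p + q] ([b = false]). *)
Definition letter (b : bool) P : A * A :=
  if b then (P.1, P.2 * P.1) else (P.2 * P.1, P.2).

Definition run w P : A * A := foldl (fun P b => letter b P) P w.

Lemma run_cat w w' P : run (w ++ w') P = run w' (run w P).
Proof. exact: foldl_cat. Qed.

(** Simultaneous conjugacy: for matrices over a commutative ring, [k * h = 1] makes [h]
    invertible. *)
Definition intertwined P P' := exists h k : A,
  [/\ k * h = 1, h * P.1 = P'.1 * h & h * P.2 = P'.2 * h].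

Lemma intertwined_trans P1 P2 P3 :
  intertwined P1 P2 -> intertwined P2 P3 -> intertwined P1 P3.
Proof.
move=> [h [k [kh hx hy]]] [h' [k' [kh' hx' hy']]].
exists (h' * h), (k * k'); split.
- by rewrite mulrA -(mulrA k) kh' mulr1.
- by rewrite -mulrA hx mulrA hx' mulrA.
- by rewrite -mulrA hy mulrA hy' mulrA.
Qed.

Lemma intertwined_run w P P' : intertwined P P' -> intertwined (run w P) (run w P').
Proof.
elim: w P P' => //= b w IH P P' [h [k [kh hx hy]]]; apply: IH; exists h, k.
by case: b => /=; split=> //; rewrite mulrA hy -mulrA hx mulrA.
Qed.

Definition tame P := exists w, (run w P).1 ^+ 4 = 1.

Lemma tame_run w P : tame (run w P) -> tame P.
Proof. by move=> [w' h]; exists (w ++ w'); rewrite run_cat. Qed.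

Lemma tame_intertwined P P' : intertwined P P' -> tame P' -> tame P.
Proof.
move=> PP' [w h]; exists w.
have [l [k [kl lx _]]] := intertwined_run w PP'.
rewrite -[LHS]mul1r -kl -mulrA.
suff -> n : l * (run w P).1 ^+ n = (run w P').1 ^+ n * l by rewrite h mul1r.
elim: n => [|n IH]; first by rewrite !expr0 mulr1 mul1r.
by rewrite !exprSr mulrA IH -mulrA lx mulrA.
Qed.

End Words.

(** * Affine isometries as matrices *)

Section Affine.
Variable A : comNzRingType.

(** The translation sits in the bottom row and is expressed in the moving frame, since the matrix
    multiplies from the left the rows of a frame. *)
Definition aff (a00 a01 a02 a10 a11 a12 a20 a21 a22 v0 v1 v2 : A) : 'M[A]_4 :=
  \matrix_(i, j) nth 0 (nth [::] [:: [:: a00; a01; a02; 0]; [:: a10; a11; a12; 0];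
    [:: a20; a21; a22; 0]; [:: v0; v1; v2; 1]] i) j.

Lemma affM a00 a01 a02 a10 a11 a12 a20 a21 a22 v0 v1 v2
  b00 b01 b02 b10 b11 b12 b20 b21 b22 w0 w1 w2 :
  aff a00 a01 a02 a10 a11 a12 a20 a21 a22 v0 v1 v2 *
  aff b00 b01 b02 b10 b11 b12 b20 b21 b22 w0 w1 w2 =
  aff (a00 * b00 + a01 * b10 + a02 * b20) (a00 * b01 + a01 * b11 + a02 * b21)
      (a00 * b02 + a01 * b12 + a02 * b22)
      (a10 * b00 + a11 * b10 + a12 * b20) (a10 * b01 + a11 * b11 + a12 * b21)
      (a10 * b02 + a11 * b12 + a12 * b22)
      (a20 * b00 + a21 * b10 + a22 * b20) (a20 * b01 + a21 * b11 + a22 * b21)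
      (a20 * b02 + a21 * b12 + a22 * b22)
      (v0 * b00 + v1 * b10 + v2 * b20 + w0) (v0 * b01 + v1 * b11 + v2 * b21 + w1)
      (v0 * b02 + v1 * b12 + v2 * b22 + w2).
Proof.
apply/matrixP => i j; rewrite mxE !big_ord_recl big_ord0 !mxE /=.
by case: i => [[|[|[|[|[]]]]] hi] //; case: j => [[|[|[|[|[]]]]] hj] //=; ring.
Qed.

Lemma aff1 : 1 = aff 1 0 0 0 1 0 0 0 1 0 0 0.
Proof.
apply/matrixP => i j; rewrite !mxE /=.
by case: i => [[|[|[|[|[]]]]] hi] //; case: j => [[|[|[|[|[]]]]] hj].
Qed.

(* Matrices act on the left on the rows [e, f, n, w] of a frame of a square, see
   [pos] below: [e] and [f] are the directions of its edges, [n] is the normal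
   towards which the surface turns across the edges orthogonal to [e], and
   away from which it turns across the edges orthogonal to [f]. *)
Definition cross_right : 'M[A]_4 := aff 0 0 1 0 1 0 (-1) 0 0 0 0 0.
Definition cross_up : 'M[A]_4 := aff 1 0 0 0 0 (-1) 0 1 0 0 1 (-1).

(* The normal form of the pairs conjugate to a descendant of the two crossings
   that have the same linear parts as these; [a = 0] makes the first rotation of
   finite order, and [c] stays odd. *)
Definition model (a c : A) : 'M[A]_4 * 'M[A]_4 :=
  (aff 0 0 1 0 1 0 (-1) 0 0 0 (2 * a) 0,
   aff 1 0 0 0 0 (-1) 0 1 0 (- 2 * a) 0 (2 * c)).

(** The linear part has order 3 and permutes the axes cyclically up to signs; [rot3V] has the
    inverse linear part. Together with the translations they provide all the conjugators below. *)
Definition rot3 (u0 u1 u2 : A) := aff 0 1 0 0 0 (-1) (-1) 0 0 u0 u1 u2.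
Definition rot3V (u0 u1 u2 : A) := aff 0 0 (-1) 1 0 0 0 (-1) 0 u0 u1 u2.
Definition transl (u0 u1 u2 : A) := aff 1 0 0 0 1 0 0 0 1 u0 u1 u2.

End Affine.

(** * Conjugacies between descendants of the models *)

Section Transitions.
Variable A : comNzRingType.
Implicit Types a c : A.
Notation T := true.
Notation U := false.

Ltac crunch := split; rewrite /= /rot3 /rot3V /transl ?aff1 !affM; congr aff; ring.

(** Four letters turn y into y x^4, where x^4 is the translation by [8 * a] along the axis of x; a
    translation then restores the normal form. *)
Lemma model_TTTT a c :
  intertwined (run [:: T; T; T; T] (model a c))
    (model a (c - 4 * a)).
Proof.
by exists (transl 0 (8 * a) 0),
  (transl 0 (- (8 * a)) 0); crunch.
Qed.

Lemma model_UUUU a c :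
  intertwined (run [:: U; U; U; U] (model a c))
    (model a (4 * a + c)).
Proof.
by exists (transl (4 * a) (- (4 * a)) (- (4 * a))),
  (transl (- (4 * a)) (4 * a) (4 * a)); crunch.
Qed.

(** Here the linear parts come back only after a cyclic permutation of the axes, which a rotation of
    order 3 undoes. *)
Lemma model_TUUT a c :
  intertwined (run [:: T; U; U; T] (model a c))
    (model (c - a) (- c)).
Proof.
by exists (rot3 c (2 * a + c) (- c)),
  (rot3V (- (2 * a) - c) (- c) c); crunch.
Qed.

Lemma model_UTTU a c :
  intertwined (run [:: U; T; T; U] (model a c))
    (model (- a - c) (- c)).
Proof.
by exists (rot3V (2 * a + c) (- c) c),
  (rot3 c (- (2 * a) - c) (- c)); crunch.
Qed.

(** This and the following transitions treat the words, other than the two pure loops, that leave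
    [stems] when a letter is added. *)
Lemma model_TTU a c :
  intertwined (run [:: T; T; U] (model a c))
    (run [:: U; T] (model (- a) (4 * a - c))).
Proof.
by exists (rot3V (c - 2 * a) (4 * a + c) (c - 4 * a)),
  (rot3 (c - 4 * a) (2 * a - c) (4 * a + c)); crunch.
Qed.

Lemma model_TUT a c :
  intertwined (run [:: T; U; T] (model a c))
    (run [:: U; U] (model (a - c) c)).
Proof.
by exists (rot3V 0 (2 * a + 2 * c) (2 * a - 2 * c)),
  (rot3 (2 * a - 2 * c) 0 (2 * a + 2 * c)); crunch.
Qed.

Lemma model_TUU a c :
  intertwined (run [:: T; U; U] (model a c))
    (run [:: T; T; T] (model (c - a) (3 * c - 4 * a))).
Proof.
by exists (rot3 c (2 * a + c) (7 * c - 8 * a)),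
  (rot3V (- (2 * a) - c) (7 * c - 8 * a) c); crunch.
Qed.

Lemma model_UTT a c :
  intertwined (run [:: U; T; T] (model a c))
    (run [:: U; U; U] (model (- a - c) (4 * a + 3 * c))).
Proof.
by exists (rot3V (- (2 * a) - 3 * c) (4 * a + 3 * c) (- (4 * a) - 3 * c)),
  (rot3 (- (4 * a) - 3 * c) (2 * a + 3 * c) (4 * a + 3 * c)); crunch.
Qed.

Lemma model_UTU a c :
  intertwined (run [:: U; T; U] (model a c))
    (run [:: T; T] (model (a + c) c)).
Proof.
by exists (rot3 (2 * a) 0 (2 * a + 4 * c)),
  (rot3V 0 (2 * a + 4 * c) (2 * a)); crunch.
Qed.

Lemma model_UUT a c :
  intertwined (run [:: U; U; T] (model a c))
    (run [:: T; U] (model (- a) (- (4 * a) - c))).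
Proof.
by exists (rot3 (- c) (2 * a + c) (- (8 * a) - c)),
  (rot3V (- (2 * a) - c) (- (8 * a) - c) (- c)); crunch.
Qed.

Lemma model_TTTU a c :
  intertwined (run [:: T; T; T; U] (model a c))
    (run [:: T] (model (- a) (4 * a - c))).
Proof.
by exists (rot3V (c - 2 * a) (4 * a + c) (c - 4 * a)),
  (rot3 (c - 4 * a) (2 * a - c) (4 * a + c)); crunch.
Qed.

Lemma model_UUUT a c :
  intertwined (run [:: U; U; U; T] (model a c))
    (run [:: U] (model (- a) (- (4 * a) - c))).
Proof.
by exists (rot3 (- c) (2 * a + c) (- (8 * a) - c)),
  (rot3V (- (2 * a) - c) (- (8 * a) - c) (- c)); crunch.
Qed.

End Transitions.

(* Euclid's algorithm on [a, c]: the two twists shift [c] by multiples of [4 * a],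
   and two other loops shift [a] by [c] up to signs; as [c] is odd, it never
   happens that [`|c| = 2 * `|a|]. *)
Lemma tame_model (a c : int) : ~~ (2 %| c)%Z -> tame (model a c).
Proof.
have [n] := ubnP (absz a + absz c)%N; elim: n a c => // n IH a c lt_n c_odd.
have [-> | a0] := eqVneq a 0.
  by exists [::]; rewrite /= !exprS expr0 mulr1 !affM aff1; congr aff; ring.
have next w a' c' : intertwined (run w (model a c)) (model a' c') ->
    (absz a' + absz c' < n)%N -> ~~ (2 %| c')%Z -> tame (model a c).
  by move=> E lt_n' c'_odd; apply/tame_run/(tame_intertwined E)/IH.
have [lt_ac | le_ca] := ltP (2 * `|a|) `|c|.
  have [] : (absz a + absz (c - 4 * a)%R < n)%N \/ (absz a + absz (4 * a + c)%R < n)%N.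
  - lia.
  - by move=> h; apply: (next _ _ _ (model_TTTT a c)) => //; lia.
  - by move=> h; apply: (next _ _ _ (model_UUUU a c)) => //; lia.
have [] : (absz (c - a)%R + absz (- c)%R < n)%N \/ (absz (- a - c)%R + absz (- c)%R < n)%N.
- lia.
- by move=> h; apply: (next _ _ _ (model_TUUT a c)) => //; lia.
- by move=> h; apply: (next _ _ _ (model_UTTU a c)) => //; lia.
Qed.

(* Up to conjugacy the linear parts of the descendants of the two crossings form
   nine orbits, reached from the model by these words. *)
Definition stems : seq (seq bool) := [:: [::]; [:: true]; [:: false];
  [:: true; true]; [:: true; false]; [:: false; true]; [:: false; false];
  [:: true; true; true]; [:: false; false; false]].

(** Of the eighteen one-letter extensions of stems eight are stems again; the other ten are
    left-hand sides of transitions. *)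
Lemma stem_letter v b (a c : int) : v \in stems -> ~~ (2 %| c)%Z ->
  exists v' a' c', [/\ v' \in stems, ~~ (2 %| c')%Z &
    intertwined (letter b (run v (model a c))) (run v' (model a' c'))].
Proof.
move=> vS c_odd; have -> : letter b (run v (model a c)) = run (rcons v b) (model a c).
  by rewrite -cats1 run_cat.
have refl P : intertwined P P by exists 1, 1; rewrite !mulr1 !mul1r.
have stay : rcons v b \in stems -> exists v' a' c', [/\ v' \in stems, ~~ (2 %| c')%Z &
    intertwined (run (rcons v b) (model a c)) (run v' (model a' c'))].
  by move=> h; exists (rcons v b), a, c.
move: vS; rewrite !inE.
do 8? [case/orP => [/eqP ev|]]; last (move=> /eqP ev);
  move: stay; rewrite {}ev; case: b => /= stay; try exact: stay.
- by exists [:: false; true], (- a), (4 * a - c); split=> //; [lia | exact: model_TTU].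
- by exists [:: false; false], (a - c), c; split=> //; exact: model_TUT.
- by exists [:: true; true; true], (c - a), (3 * c - 4 * a); split=> //; [lia | exact: model_TUU].
- by eexists [:: false; false; false], _, _; split; last exact: model_UTT; [| lia].
- by eexists [:: true; true], _, _; split; last exact: model_UTU; [| lia].
- by eexists [:: true; false], _, _; split; last exact: model_UUT; [| lia].
- by eexists [::], _, _; split; last exact: model_TTTT; [| lia].
- by eexists [:: true], _, _; split; last exact: model_TTTU; [| lia].
- by eexists [:: false], _, _; split; last exact: model_UUUT; [| lia].
- by eexists [::], _, _; split; last exact: model_UUUU; [| lia].
Qed.

(** Each stem is a prefix of one of the four loops, and completing the loop leads to a model. *)
Lemma tame_stem v (a c : int) : v \in stems -> ~~ (2 %| c)%Z ->
  tame (run v (model a c)).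
Proof.
move=> vS c_odd.
have close v' a' c' : intertwined (run (v ++ v') (model a c)) (model a' c') ->
    ~~ (2 %| c')%Z -> tame (run v (model a c)).
  by move=> E c'_odd; apply: (@tame_run _ v'); rewrite -run_cat;
    apply: (tame_intertwined E); apply: tame_model.
move: vS; rewrite !inE.
do 8? [case/orP => [/eqP ev|]]; last (move=> /eqP ev); rewrite {}ev in close *.
- exact: tame_model.
- by apply: (close [:: true; true; true]); [exact: model_TTTT | lia].
- by apply: (close [:: false; false; false]); [exact: model_UUUU | lia].
- by apply: (close [:: true; true]); [exact: model_TTTT | lia].
- by apply: (close [:: false; true]); [exact: model_TUUT | lia].
- by apply: (close [:: true; false]); [exact: model_UTTU | lia].
- by apply: (close [:: false; false]); [exact: model_UUUU | lia].
- by apply: (close [:: true]); [exact: model_TTTT | lia].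
- by apply: (close [:: false]); [exact: model_UUUU | lia].
Qed.

Notation right := (cross_right int).
Notation up := (cross_up int).

Lemma tame_crossings w : tame (run w (right, up)).
Proof.
suff [v [a [c [vS c_odd E]]]] : exists v a c, [/\ v \in stems, ~~ (2 %| c)%Z &
    intertwined (run w (right, up)) (run v (model a c))].
  by apply: (tame_intertwined E); apply: tame_stem.
elim/last_ind: w => [|w b [v [a [c [vS c_odd E]]]]].
  (* The axes of the two crossings are at distance 1, whence c = -1; a unit translation along the
     axis of x normalises y. *)
  exists [::], 0, (-1); split=> //; exists (transl 0 1 0), (transl 0 (-1) 0).
  by split; rewrite /= /transl ?aff1 !affM; congr aff; ring.
have [v' [a' [c' [v'S c'_odd E']]]] := stem_letter b a vS c_odd.
exists v', a', c'; split=> //; apply: intertwined_trans E'.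
by rewrite -cats1 run_cat; apply: (@intertwined_run _ [:: b]).
Qed.

(** * Slopes of words, and density of those of finite order *)

Fixpoint slope (w : seq bool) : nat * nat :=
  if w is b :: w' then
    let: (q, p) := slope w' in if b then (q + p, p)%N else (q, p + q)%N
  else (1, 0)%N.

Lemma eventually_periodic_word (R : realDomainType) (n : nat) w (P : 'M[int]_4 * 'M[int]_4) :
  (run w P).1 ^+ 4 = 1 ->
  eventually_periodic (slope w).1%:R ((slope w).2%:R : R)
    (@mulmx int 4 4 n P.1) (mulmx P.2).
Proof.
elim: w P => [|b w IH] P /=.
  move=> x4 [d g] /= /andP[d0 d1]; exists 0%N, 3%N.
  have it k : iter k (cut_step 1 (0 : R) (mulmx P.1) (mulmx P.2)) (d, g) =
      (d, P.1 ^+ k *m g).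
    elim: k => [|k IHk]; first by rewrite expr0 mul1mx.
    by rewrite iterS IHk /cut_step /= ifT ?addr0 ?exprS ?mulmxA //; lra.
  by rewrite it x4 mul1mx.
have mulmx_comp : mulmx (P.2 * P.1) = mulmx P.2 \o @mulmx int 4 4 n P.1.
  by apply: funext => g /=; rewrite mulmxA.
move/IH; case: (slope w) => q p.
case: b => /=; rewrite natrD mulmx_comp.
- exact: eventually_periodic_T.
- exact: eventually_periodic_U.
Qed.

Lemma slope_gt0 w : (0 < (slope w).1 + (slope w).2)%N.
Proof. by elim: w => //= b w; case: (slope w) => q p /=; case: b => /=; lia. Qed.

(** A word acts on slopes by a matrix of determinant 1, so its extensions have slopes in the cone
    spanned by the columns, the first of which is its own slope. *)
Lemma slope_cat w : exists q p : nat,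
  ((slope w).1 * p = (slope w).2 * q + 1)%N /\
  forall w', slope (w ++ w') =
    ((slope w).1 * (slope w').1 + q * (slope w').2,
     (slope w).2 * (slope w').1 + p * (slope w').2)%N.
Proof.
elim: w => [|b w [q [p [det E]]]] /=.
  by exists 0%N, 1%N; split=> // w'; rewrite [LHS]surjective_pairing; congr pair; lia.
case: (slope w) det E => q1 p1 /= det E.
case: b; [exists (q + p)%N, p | exists q, (p + q)%N];
  by split=> [|w']; rewrite ?E /=; [lia | congr pair; lia].
Qed.

Lemma slope_T n w : slope (nseq n true ++ w) = ((slope w).1 + n * (slope w).2, (slope w).2)%N.
Proof.
elim: n => [|n IH] /=; last by rewrite IH; congr pair; lia.
by rewrite mul0n addn0 -surjective_pairing.
Qed.

Lemma slope_surj q p : (0 < q)%N -> (0 < p)%N ->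
  exists d w, (q = d * (slope w).1 /\ p = d * (slope w).2)%N.
Proof.
have [n] := ubnP (q + p)%N; elim: n q p => // n IH q p lt_n q0 p0.
have [lt_qp | lt_pq | ->] := ltngtP q p.
- have [||| d [w [Eq Ep]]] := IH q (p - q)%N; try lia.
  exists d, (false :: w) => /=; case: (slope w) Eq Ep => a b /=; lia.
- have [||| d [w [Eq Ep]]] := IH (q - p)%N p; try lia.
  exists d, (true :: w) => /=; case: (slope w) Eq Ep => a b /=; lia.
- by exists p, [:: false] => /=; lia.
Qed.

Lemma tame_slope_dense (R : realType) (a b : R) : 0 < a -> a < b ->
  exists w, [/\ (run w (right, up)).1 ^+ 4 = 1,
    (0 < (slope w).1)%N, (0 < (slope w).2)%N &
    a < (slope w).2%:R / (slope w).1%:R < b].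
Proof.
move=> a0 ab; have [x] := rat_in_itvoo ab; rewrite in_itv /= => /andP[ax xb].
have x0 : 0 < x by rewrite -(ltr0q R); lra.
have [q1 [p1 [q10 p10 Ex]]] : exists q1 p1 : nat,
    [/\ (0 < q1)%N, (0 < p1)%N & ratr x = p1%:R / q1%:R :> R].
  exists (absz (denq x)), (absz (numq x)); split.
  - by rewrite absz_gt0 denq_neq0.
  - by rewrite absz_gt0 numq_eq0 lt0r_neq0.
  - by rewrite /ratr !natr_absz ger0_norm ?numq_ge0 ?ltW // ger0_norm ?denq_ge0.
have [d [w0 [Eq Ep]]] := slope_surj q10 p10.
have [c [p2 [det slopeE]]] := slope_cat w0.
(* The length [n] is fixed before the extension [w1] is known: [n] letters [true] after [w0] confine
   the slope of every further extension to [x, x + 1/n]. *)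
pose n := (Num.bound (b - ratr x)^-1).+1.
have nb : ratr x + n%:R^-1 < b.
  have bx : 0 < b - ratr x by lra.
  suff : n%:R^-1 < b - ratr x by lra.
  rewrite -[ltRHS]invrK ltf_pV2 ?posrE ?invr_gt0 ?ltr0n //.
  apply: (lt_trans (archi_boundP _)); first by rewrite invr_ge0 ltW.
  by rewrite ltr_nat.
have [w1 tm] := tame_crossings (w0 ++ nseq n true).
exists ((w0 ++ nseq n true) ++ w1); split; first by rewrite run_cat.
all: rewrite -catA slopeE slope_T /=.
all: move: (slope_gt0 w1) Ex Eq Ep det; case: (slope w1) (slope w0) => s t [q p] /= st0 Ex Eq Ep det.
all: have [q0 p0] : (0 < q)%N /\ (0 < p)%N by nia.
all: have n0 : (0 < n)%N by []; have st : (0 < s + n * t)%N by nia.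
- by rewrite addn_gt0 muln_gt0 q0 st.
- by rewrite addn_gt0 muln_gt0 p0 st.
set Q := (q * _ + _)%N; set P := (p * _ + _)%N.
have Q0 : (0 < Q)%N by rewrite /Q addn_gt0 muln_gt0 q0 st.
have Ex' : ratr x = p%:R / q%:R :> R.
  by rewrite Ex Eq Ep !natrM -mulf_div divff ?mul1r // pnatr_eq0; nia.
(* By the determinant, P / Q exceeds p / q by exactly t / (q Q). *)
have detPQ : (P * q = p * Q + t)%N by rewrite /P /Q; nia.
have ntQ : (n * t <= q * Q)%N by rewrite /Q; nia.
have qR : 0 < q%:R :> R by rewrite ltr0n.
have QR : 0 < Q%:R :> R by rewrite ltr0n.
have E : P%:R / Q%:R = ratr x + t%:R / (q%:R * Q%:R) :> R.
  rewrite Ex'; apply/eqP; rewrite -subr_eq0.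
  have := congr1 (GRing.natmul (1 : R)) detPQ; rewrite natrD !natrM => detR.
  suff -> : P%:R / Q%:R - (p%:R / q%:R + t%:R / (q%:R * Q%:R)) =
    (P%:R * q%:R - (p%:R * Q%:R + t%:R)) / (q%:R * Q%:R) :> R by rewrite detR subrr mul0r.
  by field; rewrite ?(lt0r_neq0 qR) ?(lt0r_neq0 QR).
rewrite E; apply/andP; split.
  by apply: (lt_le_trans ax); rewrite lerDl divr_ge0 ?mulr_ge0.
apply: le_lt_trans nb; rewrite lerD2l ler_pdivrMr ?mulr_gt0 //.
by rewrite ler_pdivlMl ?ltr0n // -!natrM ler_nat.
Qed.

(** * Integer frames of squares *)

Notation row_e := (@Ordinal 4 0 isT).
Notation row_f := (@Ordinal 4 1 isT).
Notation row_n := (@Ordinal 4 2 isT).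
Notation row_w := (@Ordinal 4 3 isT).

(** This and the next two matrices give other frames of the same square. Exchanging e and f
    exchanges turning towards n with turning away from it, so [swap] must pass to the cube on the
    other side of the square. *)
Definition flip_e : 'M[int]_4 := aff (-1) 0 0 0 1 0 0 0 1 0 0 0.
Definition flip_f : 'M[int]_4 := aff 1 0 0 0 (-1) 0 0 0 1 0 0 0.
Definition swap : 'M[int]_4 := aff 0 1 0 1 0 0 0 0 (-1) 0 0 (-1).

Section Frames.
Variable R : realType.
Implicit Types (g : 'M[int]_(4, 3)) (i j k l : 'I_3) (p : 'rV[R]_3) (al be : R).

Lemma affE a00 a01 a02 a10 a11 a12 a20 a21 a22 v0 v1 v2 g l :
  let g' := aff a00 a01 a02 a10 a11 a12 a20 a21 a22 v0 v1 v2 *m g in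
  [/\ g' row_e l = a00 * g row_e l + a01 * g row_f l + a02 * g row_n l,
      g' row_f l = a10 * g row_e l + a11 * g row_f l + a12 * g row_n l,
      g' row_n l = a20 * g row_e l + a21 * g row_f l + a22 * g row_n l &
      g' row_w l = v0 * g row_e l + v1 * g row_f l + v2 * g row_n l + g row_w l].
Proof.
rewrite /=; split; rewrite mxE !big_ord_recl big_ord0 !mxE /= ?mul0r ?mul1r ?addr0 ?addrA.
all: do ?[congr (_ + _)]; try (congr (_ * _)); congr (g _ _); exact: val_inj.
Qed.

Lemma rightE g l : [/\ (right *m g) row_e l = g row_n l, (right *m g) row_f l = g row_f l,
  (right *m g) row_n l = - g row_e l & (right *m g) row_w l = g row_w l].
Proof. by rewrite /cross_right; have [-> -> -> ->] := affE 0 0 1 0 1 0 (-1) 0 0 0 0 0 g l; split; ring. Qed.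

Lemma flip_eE g l : [/\ (flip_e *m g) row_e l = - g row_e l, (flip_e *m g) row_f l = g row_f l,
  (flip_e *m g) row_n l = g row_n l & (flip_e *m g) row_w l = g row_w l].
Proof. by rewrite /flip_e; have [-> -> -> ->] := affE (-1) 0 0 0 1 0 0 0 1 0 0 0 g l; split; ring. Qed.

Lemma flip_fE g l : [/\ (flip_f *m g) row_e l = g row_e l, (flip_f *m g) row_f l = - g row_f l,
  (flip_f *m g) row_n l = g row_n l & (flip_f *m g) row_w l = g row_w l].
Proof. by rewrite /flip_f; have [-> -> -> ->] := affE 1 0 0 0 (-1) 0 0 0 1 0 0 0 g l; split; ring. Qed.

Lemma swapE g l : [/\ (swap *m g) row_e l = g row_f l, (swap *m g) row_f l = g row_e l,
  (swap *m g) row_n l = - g row_n l & (swap *m g) row_w l = g row_w l - g row_n l].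
Proof. by rewrite /swap; have [-> -> -> ->] := affE 0 1 0 1 0 0 0 0 (-1) 0 0 (-1) g l; split; ring. Qed.

(** Crossing right, turning round and crossing right again leads back to the square, turned
    round. *)
Lemma right_flip_e_right g : right *m (flip_e *m (right *m g)) = flip_e *m g.
Proof.
rewrite !mulmxA; congr mulmx; rewrite /cross_right /flip_e.
by rewrite -!/(GRing.mul _ _) !affM; congr aff; ring.
Qed.

Lemma right_flip_f g : right *m (flip_f *m g) = flip_f *m (right *m g).
Proof.
by rewrite !mulmxA; congr mulmx; rewrite -!/(GRing.mul _ _) !affM; congr aff; ring.
Qed.

Lemma up_swap g : up *m (swap *m g) = swap *m (right *m g).
Proof.
by rewrite !mulmxA; congr mulmx; rewrite -!/(GRing.mul _ _) !affM; congr aff; ring.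
Qed.

(** The cube has centre w + 1, and its side opposite to n has centre w + 1 - n / 2; on this side
    [al] and [be] run over [0, 1]. *)
Definition pos g al be : 'rV[R]_3 := \row_l
  (1 + (g row_w l)%:~R - (g row_n l)%:~R / 2
   + (al - 2^-1) * (g row_e l)%:~R + (be - 2^-1) * (g row_f l)%:~R).

Lemma pos_right g be : pos (right *m g) 0 be = pos g 1 be.
Proof. by apply/rowP => l; rewrite [LHS]mxE [RHS]mxE; have [-> -> -> ->] := rightE g l; rewrite rmorphN /=; field. Qed.

Lemma pos_flip_e g al be : pos (flip_e *m g) al be = pos g (1 - al) be.
Proof. by apply/rowP => l; rewrite [LHS]mxE [RHS]mxE; have [-> -> -> ->] := flip_eE g l; rewrite rmorphN /=; field. Qed.

Lemma pos_flip_f g al be : pos (flip_f *m g) al be = pos g al (1 - be).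
Proof. by apply/rowP => l; rewrite [LHS]mxE [RHS]mxE; have [-> -> -> ->] := flip_fE g l; rewrite rmorphN /=; field. Qed.

Lemma pos_swap g al be : pos (swap *m g) al be = pos g be al.
Proof. by apply/rowP => l; rewrite [LHS]mxE [RHS]mxE; have [-> -> -> ->] := swapE g l; rewrite rmorphB rmorphN /=; field. Qed.

Definition sign (s : int) := s = 1 \/ s = -1.

(* The vector [w] indexes the unit cube with lower corner [w + 1/2]; the square is
   its side opposite to [n].  The parity conditions say that the four sides of
   this cube that are parallel to [f] form a closed tube of the surface. *)
Record framed i j k (s1 s2 s3 : int) g : Prop := Framed {
  fr_axes : [/\ i != j, i != k & j != k];
  fr_signs : [/\ sign s1, sign s2 & sign s3];
  fr_rows : forall l, [/\ g row_e l = if l == i then s1 else 0,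
     g row_f l = if l == j then s2 else 0 & g row_n l = if l == k then s3 else 0];
  fr_even : (2 %| g row_w i - g row_w k)%Z;
  fr_odd : ~~ (2 %| g row_w j - g row_w k)%Z }.

Definition adapted g := exists i j k s1 s2 s3, framed i j k s1 s2 s3 g.

Lemma axes_cases i j k l : [/\ i != j, i != k & j != k] -> [\/ l = i, l = j | l = k].
Proof.
move=> ax; suff : [|| l == i, l == j | l == k].
  by case/or3P => /eqP; [constructor 1 | constructor 2 | constructor 3].
case: ax; rewrite -!val_eqE /=.
by case: i j k l => [[|[|[|//]]] ?] [[|[|[|//]]] ?] [[|[|[|//]]] ?] [[|[|[|//]]] ?].
Qed.

Lemma framed_right i j k s1 s2 s3 g : framed i j k s1 s2 s3 g ->
  framed k j i s3 s2 (- s1) (right *m g).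
Proof.
case=> [[ij ik jk] [S1 S2 S3] rows ev od]; split.
- by rewrite eq_sym jk eq_sym ik eq_sym ij.
- by split=> //; case: S1 => ->; [right | left].
- move=> l; have [-> -> -> _] := rightE g l; have [-> -> ->] := rows l.
  by split=> //; case: ifP; rewrite ?oppr0.
- by have [_ _ _ ->] := rightE g i; have [_ _ _ ->] := rightE g k; lia.
- by have [_ _ _ ->] := rightE g i; have [_ _ _ ->] := rightE g j; lia.
Qed.

Lemma framed_flip_e i j k s1 s2 s3 g : framed i j k s1 s2 s3 g ->
  framed i j k (- s1) s2 s3 (flip_e *m g).
Proof.
case=> [ax [S1 S2 S3] rows ev od]; split=> //.
- by split=> //; case: S1 => ->; [right | left].
- move=> l; have [-> -> -> _] := flip_eE g l; have [-> -> ->] := rows l.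
  by split=> //; case: ifP; rewrite ?oppr0.
- by have [_ _ _ ->] := flip_eE g i; have [_ _ _ ->] := flip_eE g k.
- by have [_ _ _ ->] := flip_eE g j; have [_ _ _ ->] := flip_eE g k.
Qed.

Lemma framed_flip_f i j k s1 s2 s3 g : framed i j k s1 s2 s3 g ->
  framed i j k s1 (- s2) s3 (flip_f *m g).
Proof.
case=> [ax [S1 S2 S3] rows ev od]; split=> //.
- by split=> //; case: S2 => ->; [right | left].
- move=> l; have [-> -> -> _] := flip_fE g l; have [-> -> ->] := rows l.
  by split=> //; case: ifP; rewrite ?oppr0.
- by have [_ _ _ ->] := flip_fE g i; have [_ _ _ ->] := flip_fE g k.
- by have [_ _ _ ->] := flip_fE g j; have [_ _ _ ->] := flip_fE g k.
Qed.

Lemma framed_swap i j k s1 s2 s3 g : framed i j k s1 s2 s3 g ->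
  framed j i k s2 s1 (- s3) (swap *m g).
Proof.
case=> [[ij ik jk] [S1 S2 S3] rows ev od]; split=> //.
- by rewrite eq_sym ij.
- by split=> //; case: S3 => ->; [right | left].
- move=> l; have [-> -> -> _] := swapE g l; have [-> -> ->] := rows l.
  by split=> //; case: ifP; rewrite ?oppr0.
- have [_ _ _ ->] := swapE g j; have [_ _ _ ->] := swapE g k.
  have [_ _ ->] := rows j; have [_ _ ->] := rows k.
  by rewrite eqxx (negbTE jk); case: S3 => ->; lia.
- have [_ _ _ ->] := swapE g i; have [_ _ _ ->] := swapE g k.
  have [_ _ ->] := rows i; have [_ _ ->] := rows k.
  by rewrite eqxx (negbTE ik); case: S3 => ->; lia.
Qed.

Lemma adapted_right g : adapted g -> adapted (right *m g).
Proof. by move=> [i [j [k [s1 [s2 [s3 h]]]]]]; do 6 eexists; exact: framed_right h. Qed.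
Lemma adapted_flip_e g : adapted g -> adapted (flip_e *m g).
Proof. by move=> [i [j [k [s1 [s2 [s3 h]]]]]]; do 6 eexists; exact: framed_flip_e h. Qed.
Lemma adapted_flip_f g : adapted g -> adapted (flip_f *m g).
Proof. by move=> [i [j [k [s1 [s2 [s3 h]]]]]]; do 6 eexists; exact: framed_flip_f h. Qed.
Lemma adapted_swap g : adapted g -> adapted (swap *m g).
Proof. by move=> [i [j [k [s1 [s2 [s3 h]]]]]]; do 6 eexists; exact: framed_swap h. Qed.

Lemma pos_framed i j k s1 s2 s3 g al be : framed i j k s1 s2 s3 g ->
  [/\ pos g al be 0 i = 1 + (g row_w i)%:~R + (al - 2^-1) * s1%:~R,
      pos g al be 0 j = 1 + (g row_w j)%:~R + (be - 2^-1) * s2%:~R &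
      pos g al be 0 k = 1 + (g row_w k)%:~R - s3%:~R / 2].
Proof.
case=> [[ij ik jk] _ rows _ _]; split; rewrite !mxE.
- by have [-> -> ->] := rows i; rewrite eqxx (negbTE ij) (negbTE ik) mul0r mulr0 subr0 addr0.
- by have [-> -> ->] := rows j; rewrite eqxx [j == i]eq_sym (negbTE ij) (negbTE jk) mul0r mulr0 subr0 addr0.
- by have [-> -> ->] := rows k; rewrite eqxx ![k == _]eq_sym (negbTE jk) (negbTE ik) !mulr0 !addr0.
Qed.

Definition facet g : set 'rV[R]_3 :=
  [set p | exists al be, [/\ 0 <= al <= 1, 0 <= be <= 1 & p = pos g al be]].

Lemma facet_flip_e g : facet (flip_e *m g) = facet g.
Proof.
apply/seteqP; split=> p [al [be [a b ->]]]; exists (1 - al), be; split=> //; [lra | | lra |].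
- by rewrite pos_flip_e.
- by rewrite pos_flip_e; congr pos; lra.
Qed.

Lemma facet_swap g : facet (swap *m g) = facet g.
Proof. by apply/seteqP; split=> p [al [be [a b ->]]]; exists be, al; rewrite pos_swap. Qed.

Lemma facet_square i j k s1 s2 s3 g (a : 'rV[R]_3) : framed i j k s1 s2 s3 g ->
  a 0 i = (g row_w i)%:~R + 2^-1 -> a 0 j = (g row_w j)%:~R + 2^-1 ->
  a 0 k = 1 + (g row_w k)%:~R - s3%:~R / 2 -> facet g = unit_square k a.
Proof.
move=> fr ai aj ak; have [[ij ik jk] [S1 S2 _] _ _ _] := fr.
apply/seteqP; split=> p.
  move=> [al [be [al01 be01 ->]]]; have [Ei Ej Ek] := pos_framed al be fr.
  split; first by rewrite Ek ak.
  move=> l lk; have [->|->|E] := axes_cases l (fr_axes fr); last by rewrite E eqxx in lk.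
    by rewrite Ei ai; case: S1 => ->; lra.
  by rewrite Ej aj; case: S2 => ->; lra.
move=> [pk pl]; have := pl i ik; have := pl j jk; rewrite ai aj => pj pi.
exists (2^-1 + (p 0 i - 1 - (g row_w i)%:~R) * s1%:~R), (2^-1 + (p 0 j - 1 - (g row_w j)%:~R) * s2%:~R).
split; [by case: S1 => ->; lra | by case: S2 => ->; lra |].
apply/rowP => l; set al := _ + _; set be := 2^-1 + (p 0 j - _ - _) * _.
have [Ei Ej Ek] := pos_framed al be fr.
have [->|->|->] := axes_cases l (fr_axes fr).
- by rewrite Ei /al; case: S1 => ->; lra.
- by rewrite Ej /be; case: S2 => ->; lra.
- by rewrite Ek pk ak.
Qed.

End Frames.

(** * Faces as framed squares, and their neighbours *)

Section Faces.
Variable R : realType.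
Implicit Types (g : 'M[int]_(4, 3)) (i j k l : 'I_3) (p a : 'rV[R]_3) (al be : R).

(** The point is the centre of a cell: both floors are constant on the ball of radius 1/2, so the
    closure adds nothing there. *)
Lemma checkerboard_parity (m n : int) (x y : R) :
  x = m%:~R + 1 -> y = n%:~R + 1 -> checkerboard (x, y) -> ~~ (2 %| m - n)%Z.
Proof.
move=> xm yn /(_ (ball (x, y) 2^-1)) [|v [/= vodd [vx vy]]].
  by apply: nbhsx_ballx; rewrite invr_gt0.
move: vx vy; rewrite /ball /= !ltr_norml => vx vy.
suff [<- <-] : Num.floor (v.1 - 2^-1) = m /\ Num.floor (v.2 - 2^-1) = n by [].
by split; apply: floor_def; rewrite intrD; lra.
Qed.

Lemma square_parity i j k a (ni nj : int) : [/\ i != j, i != k & j != k] ->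
  cone_point a -> unit_square k a `<=` @mucube R ->
  a 0 i = ni%:~R + 2^-1 -> a 0 j = nj%:~R + 2^-1 -> ~~ (2 %| ni - nj)%Z.
Proof.
move=> [ij ik jk] ca sub ai aj.
pose p : 'rV[R]_3 := \row_l (if l == k then a 0 l else a 0 l + 2^-1).
have pi : p 0 i = ni%:~R + 1 by rewrite mxE (negbTE ik) ai; lra.
have pj : p 0 j = nj%:~R + 1 by rewrite mxE (negbTE jk) aj; lra.
have /sub pM : unit_square k a p.
  split=> [|l lk]; rewrite mxE ?eqxx // (negbTE lk).
  lra.
case: (ltngtP i j) => [/pM|/pM|/val_inj E]; last by rewrite E eqxx in ij.
  exact: checkerboard_parity.
by move=> /(checkerboard_parity pj pi); lia.
Qed.

Lemma cone_point_int a l : cone_point a -> exists n : int, a 0 l = n%:~R + 2^-1.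
Proof. by move=> /(_ l) /intrP[n E]; exists n; rewrite -E subrK. Qed.

Lemma axes_exist k : exists i j, [/\ i != j, i != k & j != k].
Proof.
by case: k => [[|[|[|//]]] ?]; [exists 1, 2 | exists 0, 2 | exists 0, 1].
Qed.

Lemma face_facet (F : set 'rV[R]_3) : face F -> exists2 g, adapted g & F = facet g.
Proof.
move=> [k [a [ca -> sub]]]; have [i [j ax]] := axes_exist k.
have [[ij ik jk] ji] := (ax, ax).
have [ni ai] := cone_point_int i ca; have [nj aj] := cone_point_int j ca.
have [nk ak] := cone_point_int k ca.
have par := square_parity ax ca sub ai aj.
(* Of the two cubes sharing the square exactly one satisfies [fr_even]; [s] points from the square
   into it. *)
pose s := if (2 %| ni - nk)%Z then 1 else -1 : int.
pose wk := if (2 %| ni - nk)%Z then nk else nk - 1.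
pose g : 'M[int]_(4, 3) := \matrix_(x, l) nth 0
  [:: (l == i)%:Z; (l == j)%:Z; if l == k then s else 0;
      if l == i then ni else if l == j then nj else wk] x.
have fr : framed i j k 1 1 s g.
  split=> //.
  - by split; rewrite /s; [left | left | case: ifP; [left | right]].
  - by move=> l; rewrite !mxE /=; do !case: eqP.
  - rewrite !mxE /= eqxx ![k == _]eq_sym (negbTE ik) (negbTE jk) /wk.
    by case: ifP => /= h; lia.
  - rewrite !mxE /= eqxx ![k == _]eq_sym (negbTE ik) (negbTE jk) [j == i]eq_sym (negbTE ij) /wk.
    by case: ifP => /= h; lia.
exists g; first by exists i, j, k, 1, 1, s.
symmetry; apply: (facet_square fr).
- by rewrite ai mxE /= eqxx.
- by rewrite aj mxE /= eqxx [j == i]eq_sym (negbTE ij).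
- rewrite ak mxE /= ![k == _]eq_sym (negbTE ik) (negbTE jk) /wk /s.
  by case: ifP => _ /=; rewrite ?intrD; lra.
Qed.

Definition orthonormal (A B : 'rV[R]_2) :=
  [/\ A 0 0 ^+ 2 + A 0 1 ^+ 2 = 1, B 0 0 ^+ 2 + B 0 1 ^+ 2 = 1 &
      A 0 0 * B 0 0 + A 0 1 * B 0 1 = 0].

(** The extra equation forces both vectors onto the coordinate axes, without telling which of them
    is horizontal. *)
Definition axial (A B : 'rV[R]_2) := orthonormal A B /\ A 0 0 * B 0 0 = 0.

Definition unrolls (f : R -> R -> 'rV[R]_2) (c A B : 'rV[R]_2) :=
  forall al be, 0 <= al <= 1 -> 0 <= be <= 1 -> f al be = c + al *: A + be *: B.

Definition chart_on g (phi : 'rV[R]_3 -> 'rV[R]_2) :=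
  exists c A B, axial A B /\ unrolls (fun al be => phi (pos g al be)) c A B.

Lemma axialN A B : axial A B -> axial (- A) B.
Proof. by case=> [[nA nB AB] h]; split; [split|]; rewrite ?mxE ?sqrrN // !mulNr -?opprD ?AB ?h oppr0. Qed.

Lemma axialC A B : axial A B -> axial B A.
Proof. by case=> [[nA nB AB] h]; split; [split|]; rewrite // mulrC // [B 0 1 * _]mulrC. Qed.

Lemma chart_on_flip_e g phi : chart_on g phi -> chart_on (flip_e *m g) phi.
Proof.
move=> [c [A [B [ax un]]]]; exists (c + A), (- A), B; split; first exact: axialN.
move=> al be al01 be01; rewrite pos_flip_e un //; last by lra.
by rewrite scalerBl scale1r scalerN addrA.
Qed.

Lemma chart_on_swap g phi : chart_on g phi -> chart_on (swap *m g) phi.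
Proof.
move=> [c [A [B [ax un]]]]; exists c, B, A; split; first exact: axialC.
by move=> al be al01 be01; rewrite pos_swap un // addrAC.
Qed.

Lemma pos_facet g al be : 0 <= al <= 1 -> 0 <= be <= 1 -> facet g (pos g al be).
Proof. by move=> a b; exists al, be. Qed.

(** Besides the square itself, three lattice squares contain its right edge: parity excludes the
    coplanar one and one of the two perpendicular ones, leaving a side of the same cube. *)
Lemma edge_neighbor i j k s1 s2 s3 g (G : set 'rV[R]_3) a :
  framed i j k s1 s2 s3 g -> face G -> cone_point a ->
  facet g `&` G = unit_edge j a -> a 0 i = 1 + (g row_w i)%:~R + s1%:~R / 2 ->
  a 0 j = (g row_w j)%:~R + 2^-1 -> a 0 k = 1 + (g row_w k)%:~R - s3%:~R / 2 ->
  G = facet (right *m g).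
Proof.
move=> fr [m [b [cb -> sub]]] ca FG ai aj ak.
have [ax [S1 S2 S3] rows ev od] := fr; have [ij ik jk] := ax.
have aE : unit_edge j a a by split=> //; lra.
have shiftE l : (a + delta_mx 0 j) 0 l = a 0 l + (l == j)%:R by rewrite !mxE eqxx.
have a'E : unit_edge j a (a + delta_mx 0 j).
  split=> [|l lj]; rewrite shiftE ?eqxx ?(negbTE lj) ?addr0 //=; lra.
have [_ [am al]] : (facet g `&` unit_square m b) a by rewrite FG.
have [_ [a'm a'l]] : (facet g `&` unit_square m b) (a + delta_mx 0 j) by rewrite FG.
have mj : m != j.
  by apply/eqP => E; move: a'm; rewrite shiftE am E eqxx /=; lra.
have bj : b 0 j = a 0 j.
  by have := al j; have := a'l j; rewrite eq_sym mj shiftE eqxx /= => /(_ isT) h1 /(_ isT) h2; lra.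
have [nj bjE] := cone_point_int j cb; have [ni biE] := cone_point_int i cb.
have [nk bkE] := cone_point_int k cb.
have njE : nj = g row_w j by apply: (@intr_inj R); lra.
have [Em|Em|Em] := axes_cases m ax; last first.
(* If G is coplanar, parity makes it the square itself, and the intersection is more than an
   edge. *)
- exfalso; move: al am a'm sub FG; rewrite {m mj a'l}Em => al am _ sub FG.
  have par := square_parity ax cb sub biE bjE.
  have niE : ni = g row_w i.
    have := al i ik; rewrite biE ai => /andP[h1 h2].
    have : (ni <= g row_w i + 1) && (g row_w i - 1 <= ni).
      rewrite -!(ler_int R) !intrD; case: S1 h1 h2 => -> h1 h2; lra.
    lia.
  have FE : facet g = unit_square k b.
    by apply: (facet_square fr); rewrite ?biE ?niE ?bjE ?njE // -am.
  have [_ /(_ i ij)] : unit_edge j a (pos g 0 0).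
    by rewrite -FG -FE setIid; exists 0, 0; split=> //; lra.
  have [-> _ _] := pos_framed (0 : R) 0 fr; rewrite ai.
  by case: S1 => ->; lra.
- by rewrite Em eqxx in mj.
move: al am a'm sub FG; rewrite {m mj a'l}Em => al am _ sub FG.
have par := square_parity (And3 jk (_ : j != i) (_ : k != i)) cb sub bjE bkE.
have {}par : ~~ (2 %| nj - nk)%Z by apply: par; rewrite eq_sym.
have nkE : nk = g row_w k.
  have := al k; rewrite eq_sym ik => /(_ isT); rewrite bkE ak => /andP[h1 h2].
  have : (nk <= g row_w k + 1) && (g row_w k - 1 <= nk).
    rewrite -!(ler_int R) !intrD; case: S3 h1 h2 => -> h1 h2; lra.
  lia.
symmetry; apply: (facet_square (framed_right fr)).
- by have [_ _ _ ->] := rightE g k; rewrite bkE nkE.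
- by have [_ _ _ ->] := rightE g j; rewrite bjE njE.
- by have [_ _ _ ->] := rightE g i; rewrite -am ai rmorphN /=; lra.
Qed.

End Faces.

(** * Adjacency and isometric charts in frame coordinates *)

Section Charts.
Variable R : realType.
Implicit Types (g : 'M[int]_(4, 3)) (i j k l : 'I_3) (p a : 'rV[R]_3) (al be : R).
Implicit Types (F G : set 'rV[R]_3) (phi psi : 'rV[R]_3 -> 'rV[R]_2).

Lemma framed_neighbor i j k s1 s2 s3 g G a :
  framed i j k s1 s2 s3 g -> face G -> cone_point a -> facet g `&` G = unit_edge j a ->
  exists g', [/\ adapted g', facet g' = facet g :> set 'rV[R]_3, G = facet (right *m g') &
    forall phi, chart_on g phi -> chart_on g' phi].
Proof.
move=> fr fG ca FG; have [[ij ik jk] [S1 S2 S3] _ _ _] := fr.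
have shiftE l : (a + delta_mx 0 j) 0 l = a 0 l + (l == j)%:R by rewrite !mxE eqxx.
have [[al [be [al01 be01 Ea]]] _] : (facet g `&` G) a by rewrite FG; split=> //; lra.
have [[al' [be' [al'01 be'01 Ea']]] _] : (facet g `&` G) (a + delta_mx 0 j).
  by rewrite FG; split=> [|l lj]; rewrite shiftE ?eqxx ?(negbTE lj) ?addr0 //=; lra.
have := pos_framed al be fr; rewrite -Ea => -[ai aj ak].
have := pos_framed al' be' fr; rewrite -Ea' !shiftE eqxx /= => -[_ a'j _].
have ajE : a 0 j = (g row_w j)%:~R + 2^-1.
  by case: S2 aj a'j => -> aj a'j; lra.
have [n nE] := cone_point_int i ca.
have n_w : n = g row_w i \/ n = g row_w i + 1.
  have : (n <= g row_w i + 1) && (g row_w i <= n).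
    by rewrite -!(ler_int R) !intrD; case: S1 ai => -> ai; apply/andP; split; lra.
  by clear; lia.
have : a 0 i = 1 + (g row_w i)%:~R + s1%:~R / 2 \/
       a 0 i = 1 + (g row_w i)%:~R + (- s1)%:~R / 2.
  rewrite nE; case: n_w => ->; rewrite ?intrD; case: S1 => -> ; rewrite ?opprK;
    by [left; lra | right; lra].
case=> {}ai.
  exists g; split=> //; first by do 6 eexists; exact: fr.
  exact: (edge_neighbor fr fG ca FG).
have fr' := framed_flip_e fr; have wE l : (flip_e *m g) row_w l = g row_w l.
  by have [_ _ _ ->] := flip_eE g l.
exists (flip_e *m g); split; [by do 6 eexists; exact: fr' | exact: facet_flip_e | |].
  by apply: (edge_neighbor fr' fG ca); rewrite ?facet_flip_e ?wE.
by move=> phi; exact: chart_on_flip_e.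
Qed.

Lemma adjacent_neighbor g G : adapted g -> Defs.adjacent (facet g) G ->
  exists g', [/\ adapted g', facet g' = facet g :> set 'rV[R]_3, G = facet (right *m g') &
    forall phi, chart_on g phi -> chart_on g' phi].
Proof.
move=> [i [j [k [s1 [s2 [s3 fr]]]]]] [_ fG [l [a [ca FG]]]].
have shiftE m : (a + delta_mx 0 l) 0 m = a 0 m + (m == l)%:R by rewrite !mxE eqxx.
have [El|El|El] := axes_cases l (fr_axes fr); rewrite {}El in FG shiftE.
- have [|g' [ad Fg' Gg' ch]] := framed_neighbor (framed_swap fr) fG ca; rewrite ?facet_swap //.
  by exists g'; rewrite Fg' facet_swap; split=> // phi /chart_on_swap; exact: ch.
- exact: framed_neighbor fr fG ca FG.
- have [[al [be [_ _ Ea]]] _] : (facet g `&` G) a by rewrite FG; split=> //; lra.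
  have [[al' [be' [_ _ Ea']]] _] : (facet g `&` G) (a + delta_mx 0 k).
    by rewrite FG; split=> [|m mk]; rewrite shiftE ?eqxx ?(negbTE mk) ?addr0 //=; lra.
  have := pos_framed al be fr; rewrite -Ea => -[_ _ ak].
  have := pos_framed al' be' fr; rewrite -Ea' !shiftE eqxx /= => -[_ _ a'k].
  by exfalso; move: ak a'k; clear; lra.
Qed.

Lemma sum3 (F : 'I_3 -> R) i j k : [/\ i != j, i != k & j != k] ->
  \sum_l F l = F i + F j + F k.
Proof.
move=> [ij ik jk]; rewrite (bigD1 i) // (bigD1 j) 1?eq_sym //= (bigD1 k) /=; last first.
  by rewrite eq_sym ik eq_sym jk.
rewrite big1 ?addr0 ?addrA // => l /andP[/andP[li lj] lk].
by have [E|E|E] := axes_cases l (And3 ij ik jk); rewrite E eqxx in li lj lk.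
Qed.

Lemma enorm2 (n : nat) (v : 'rV[R]_n) : enorm v ^+ 2 = \sum_i v 0 i ^+ 2.
Proof. by rewrite sqr_sqrtr // sumr_ge0 // => i _; exact: sqr_ge0. Qed.

Lemma enorm2_pos g al be al' be' : adapted g ->
  enorm (pos g al be - pos g al' be') ^+ 2 = (al - al') ^+ 2 + (be - be') ^+ 2.
Proof.
move=> [i [j [k [s1 [s2 [s3 fr]]]]]]; rewrite enorm2 (sum3 _ (fr_axes fr)).
have [_ [S1 S2 _] _ _ _] := fr.
have [Ei Ej Ek] := pos_framed al be fr; have [Ei' Ej' Ek'] := pos_framed al' be' fr.
have subE (p q : 'rV[R]_3) l : (p - q) 0 l = p 0 l - q 0 l by rewrite !mxE.
rewrite !subE Ei Ej Ek Ei' Ej' Ek'.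
by case: S1 => ->; case: S2 => ->; rewrite ?rmorphN /=; ring.
Qed.

(** As d^2 = 1, the second vector is the first one turned by a quarter turn, up to sign. *)
Lemma orthonormal2 (a1 a2 b1 b2 v1 v2 x y : R) :
  a1 ^+ 2 + a2 ^+ 2 = 1 -> b1 ^+ 2 + b2 ^+ 2 = 1 -> a1 * b1 + a2 * b2 = 0 ->
  v1 * a1 + v2 * a2 = x -> v1 * b1 + v2 * b2 = y ->
  v1 = x * a1 + y * b1 /\ v2 = x * a2 + y * b2.
Proof.
move=> a b ab <- <-; set d := a1 * b2 - a2 * b1.
have d2 : d ^+ 2 = 1.
  by rewrite -[1]mulr1 -{1}a -b /d; transitivity (d ^+ 2 + (a1 * b1 + a2 * b2) ^+ 2);
    [rewrite ab expr0n addr0 | rewrite /d; ring].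
have b1E : b1 = - a2 * d.
  by rewrite -[LHS]mul1r -a /d; transitivity (a1 * (a1 * b1 + a2 * b2) - a2 * (a1 * b2 - a2 * b1));
    [ring | rewrite ab; ring].
have b2E : b2 = a1 * d.
  by rewrite -[LHS]mul1r -a /d; transitivity (a2 * (a1 * b1 + a2 * b2) + a1 * (a1 * b2 - a2 * b1));
    [ring | rewrite ab; ring].
rewrite b1E b2E; split.
- transitivity (v1 * (a1 ^+ 2 + a2 ^+ 2 * d ^+ 2) + v2 * (a1 * a2 * (1 - d ^+ 2))); last by ring.
  by rewrite d2 mulr1 a; ring.
- transitivity (v1 * (a1 * a2 * (1 - d ^+ 2)) + v2 * (a2 ^+ 2 + a1 ^+ 2 * d ^+ 2)); last by ring.
  by rewrite d2 mulr1 addrC [a2 ^+ 2 + _]addrC a; ring.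
Qed.

Lemma row2P (u v : 'rV[R]_2) : u 0 0 = v 0 0 -> u 0 1 = v 0 1 -> u = v.
Proof.
move=> h0 h1; apply/rowP => l.
case: l => [[|[|[]]] h] //; [move: h0 | move: h1]; congr (_ = _); congr (fun_of_matrix _ _ _); exact: val_inj.
Qed.

Lemma enorm2_row2 (v : 'rV[R]_2) : enorm v ^+ 2 = v 0 0 ^+ 2 + v 0 1 ^+ 2.
Proof.
by rewrite enorm2 !big_ord_recl big_ord0 addr0; congr (_ + v 0 _ ^+ 2); exact: val_inj.
Qed.

Lemma isometric_unrolls g phi : adapted g -> isometric_on (facet g) phi ->
  exists c A B, orthonormal A B /\ unrolls (fun al be => phi (pos g al be)) c A B.
Proof.
move=> ad iso; set f := fun al be => _.
have dist al be al' be' : 0 <= al <= 1 -> 0 <= be <= 1 -> 0 <= al' <= 1 -> 0 <= be' <= 1 ->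
    (f al be 0 0 - f al' be' 0 0) ^+ 2 + (f al be 0 1 - f al' be' 0 1) ^+ 2 =
    (al - al') ^+ 2 + (be - be') ^+ 2.
  move=> al01 be01 al'01 be'01; rewrite -(enorm2_pos al be al' be' ad) -iso; try exact: pos_facet.
  by rewrite enorm2_row2 !mxE.
have u0 : 0 <= (0 : R) <= 1 by lra.
have u1 : 0 <= (1 : R) <= 1 by lra.
have dA := dist _ _ _ _ u1 u0 u0 u0; have dB := dist _ _ _ _ u0 u1 u0 u0.
have dAB := dist _ _ _ _ u1 u0 u0 u1.
exists (f 0 0), (f 1 0 - f 0 0), (f 0 1 - f 0 0).
have AB : (f 1 0 0 0 - f 0 0 0 0) * (f 0 1 0 0 - f 0 0 0 0) +
    (f 1 0 0 1 - f 0 0 0 1) * (f 0 1 0 1 - f 0 0 0 1) = 0 by lra.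
split; first by split; rewrite !mxE; lra.
move=> al be al01 be01.
have d0 := dist _ _ _ _ al01 be01 u0 u0; have d1 := dist _ _ _ _ al01 be01 u1 u0.
have d2 := dist _ _ _ _ al01 be01 u0 u1.
(* By polarisation, the squared distances to three corners give the inner products with A and B. *)
have [|||||E1 E2] := @orthonormal2 (f 1 0 0 0 - f 0 0 0 0) (f 1 0 0 1 - f 0 0 0 1)
  (f 0 1 0 0 - f 0 0 0 0) (f 0 1 0 1 - f 0 0 0 1)
  (f al be 0 0 - f 0 0 0 0) (f al be 0 1 - f 0 0 0 1) al be; [lra | lra | lra | lra | lra |].
by apply: row2P; rewrite !mxE; lra.
Qed.

End Charts.

(** * Parallel transport and unfolded trajectories *)

Section Transport.
Variable R : realType.
Implicit Types (g : 'M[int]_(4, 3)) (i j k l : 'I_3) (p a : 'rV[R]_3) (al be : R).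
Implicit Types (F G : set 'rV[R]_3) (phi psi : 'rV[R]_3 -> 'rV[R]_2).

Lemma sqr_eq1 (x : R) : x ^+ 2 = 1 -> x = 1 \/ x = -1.
Proof. by move/eqP; rewrite sqrf_eq1 => /orP[] /eqP ->; [left | right]. Qed.

Lemma axial_cases (A B : 'rV[R]_2) : axial A B -> exists s t : R,
  [/\ s = 1 \/ s = -1, t = 1 \/ t = -1 &
   [/\ A 0 0 = s, A 0 1 = 0, B 0 0 = 0 & B 0 1 = t] \/
   [/\ A 0 0 = 0, A 0 1 = s, B 0 0 = t & B 0 1 = 0]].
Proof.
move=> [[nA nB AB] h].
have zero (x y : R) : x ^+ 2 = 1 -> x * y = 0 -> y = 0.
  by move=> x1 /eqP; rewrite mulf_eq0 => /orP[/eqP x0|/eqP //]; move: x1; rewrite x0 expr0n => /esym/eqP; rewrite oner_eq0.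
have AB1 : A 0 1 * B 0 1 = 0 by rewrite -[RHS]AB h add0r.
move: (h) => /eqP; rewrite mulf_eq0 => /orP[] /eqP E.
- have A1 : A 0 1 ^+ 2 = 1 by rewrite -nA E expr0n add0r.
  have B1 := zero _ _ A1 AB1.
  exists (A 0 1), (B 0 0); split; [exact: sqr_eq1 | | by right].
  by apply: sqr_eq1; rewrite -nB B1 expr0n addr0.
- have B1 : B 0 1 ^+ 2 = 1 by rewrite -nB E expr0n add0r.
  have A1 : A 0 1 = 0 by apply: zero B1 _; rewrite mulrC.
  exists (A 0 0), (B 0 1); split; [ | exact: sqr_eq1 | by left].
  by apply: sqr_eq1; rewrite -nA A1 expr0n addr0.
Qed.

Lemma unit_square_chart_on F phi : unit_square_chart F phi ->
  exists g, [/\ adapted g, F = facet g & chart_on g phi].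
Proof.
move=> [/face_facet[g ad ->] iso im]; exists g; split=> //.
have [c [A [B [on un]]]] := isometric_unrolls ad iso.
exists c, A, B; split=> //; split=> //.
have u0 : 0 <= (0 : R) <= 1 by lra.
have u1 : 0 <= (1 : R) <= 1 by lra.
have box al be : 0 <= al <= 1 -> 0 <= be <= 1 -> forall m,
    0 <= c 0 m + al * A 0 m + be * B 0 m <= 1.
  move=> al01 be01 m; have : (phi @` facet g) (phi (pos g al be)).
    by exists (pos g al be) => //; exact: pos_facet.
  by rewrite im /= un // => /(_ m); rewrite !mxE.
have b00 := box _ _ u0 u0; have b10 := box _ _ u1 u0.
have b01 := box _ _ u0 u1; have b11 := box _ _ u1 u1.
have sqr_le1 (x : R) : -1 <= x <= 1 -> x ^+ 2 <= 1 by move=> x1; nra.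
(* The images of the diagonals, A + B and A - B, have squared length 2 and coordinates in [-1, 1],
   so all these coordinates are 1 or -1. *)
have b m : (A 0 m + B 0 m) ^+ 2 <= 1 /\ (A 0 m - B 0 m) ^+ 2 <= 1.
  have := (b00 m, b10 m, b01 m, b11 m) => -[[[h1 h2] h3] h4].
  by split; apply: sqr_le1; lra.
have [h0 h0'] := b 0; have [h1 h1'] := b 1.
have [nA nB AB] := on.
lra.
Qed.

(* The unfolding of the square framed by [g] and of its right neighbour. *)
Definition strip g al be : 'rV[R]_3 :=
  if al <= 1 then pos g al be else pos (right *m g) (al - 1) be.

Lemma strip_right g al be : 1 <= al -> strip g al be = pos (right *m g) (al - 1) be.
Proof.
rewrite /strip le_eqVlt => /orP[/eqP <-|h]; last by rewrite leNgt h.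
by rewrite lexx subrr pos_right.
Qed.

Lemma unfolding_strip F G phi : unfolding F G phi -> forall g, adapted g ->
  F = facet g -> chart_on g phi ->
  exists g' c A B, [/\ adapted g', F = facet g', G = facet (right *m g'), axial A B &
    forall al be, 0 <= al <= 2 -> 0 <= be <= 1 ->
      phi (strip g' al be) = c + al *: A + be *: B].
Proof.
move=> [adj _ isoG inj] g adg EF; rewrite EF in adj.
have [g' [ad Fg' EG ch]] := adjacent_neighbor adg adj.
move=> /ch [c [A [B [ax un]]]]; exists g', c, A, B; rewrite EF -Fg' EG in inj isoG *; split=> //.
have [c' [A' [B' [[nA' nB' AB'] un']]]] := isometric_unrolls (adapted_right ad) isoG.
have u0 : 0 <= (0 : R) <= 1 by lra.
have u1 : 0 <= (1 : R) <= 1 by lra.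
have c'E : c' = c + A.
  by have := un' 0 0 u0 u0; rewrite /= pos_right un // !scale0r scale1r !addr0.
have B'E : B' = B.
  have := un' 0 1 u0 u1; rewrite /= pos_right un // scale0r !scale1r addr0 c'E.
  by move/addrI.
have A'E : A' = A.
  (* The sign -1 would fold the second square onto the first, against injectivity: a far corner of
     the one would have the image of a far corner of the other. *)
  suff [//|E] : A' = A \/ A' = - A.
    exfalso; have := inj (pos (right *m g') 1 0) (pos g' 0 0).
    rewrite un' // un // c'E E !scale0r scale1r !addr0 addrK => H.
    have {}H : pos (right *m g') 1 0 = pos g' 0 0 :> 'rV[R]_3.
      by apply: H => //; [right | left]; apply: pos_facet.
    have [i [j [k [s1 [s2 [s3 fr]]]]]] := ad.
    have [_ _ h1] := pos_framed (1 : R) 0 (framed_right fr).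
    have [h2 _ _] := pos_framed (0 : R) 0 fr.
    have [_ _ _ w] := rightE g' i.
    have [_ [S1 _ _] _ _ _] := fr.
    move: h1; rewrite H h2 w rmorphN /=.
    by case: S1 => ->; clear; lra.
  have [[nA nB AB] _] := ax; rewrite B'E in AB'.
  have [h0 h1] := orthonormal2 nA nB AB (erefl (A' 0 0 * A 0 0 + A' 0 1 * A 0 1)) AB'.
  rewrite !mul0r !addr0 in h0 h1; move: (_ + _) h0 h1 => x h0 h1.
  have x2 : x ^+ 2 = 1 by rewrite -nA' h0 h1 !exprMn -mulrDr nA mulr1.
  by case: (sqr_eq1 x2) h0 h1 => -> h0 h1; [left | right];
    apply: row2P; rewrite ?mxE ?h0 ?h1 ?mul1r ?mulN1r.
move=> al be al02 be01; case: (leP al 1) => h.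
  by rewrite /strip h un //; lra.
rewrite strip_right ?ltW // un' //; last by lra.
by rewrite c'E A'E B'E scalerBl scale1r; congr (_ + _); rewrite -addrA; congr (_ + _); rewrite addrC subrK.
Qed.

Lemma transported_chart F0 phi0 F phi : unit_square_chart F0 phi0 ->
  transported F0 phi0 F phi -> exists g, [/\ adapted g, F = facet g & chart_on g phi].
Proof.
move=> h0 tr; elim: tr; first exact: unit_square_chart_on.
move=> {}F G {}phi psi _ [g [ad EF [c [A [B [ax un]]]]]] unf agree.
have ch : chart_on g psi.
  by exists c, A, B; split=> // al be al01 be01; rewrite agree ?un // EF; exact: pos_facet.
have [g' [c' [A' [B' [ad' _ EG ax' st]]]]] := unfolding_strip unf ad EF ch.
exists (right *m g'); split=> //; first exact: adapted_right.
exists (c' + A'), A', B'; split=> // al be al01 be01.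
have -> : pos (right *m g') al be = strip g' (al + 1) be.
  by rewrite strip_right ?addrK //; lra.
by rewrite st; [rewrite scalerDl scale1r [al *: _ + _]addrC addrA | lra |].
Qed.

Lemma strip_flip_e g al be : strip (flip_e *m (right *m g)) al be = strip g (2 - al) be.
Proof.
case: (leP al 1) => h; last first.
  rewrite strip_right ?ltW // right_flip_e_right pos_flip_e /strip ifT; last by lra.
  by congr pos; lra.
by rewrite [LHS]/strip h pos_flip_e strip_right; [congr pos; lra | lra].
Qed.

Lemma strip_flip_f g al be : strip (flip_f *m g) al be = strip g al (1 - be).
Proof. by rewrite /strip right_flip_f !pos_flip_f. Qed.

Lemma strip_facets g p : (facet g `|` facet (right *m g)) p ->
  exists al be, [/\ 0 <= al <= 2, 0 <= be <= 1 & p = strip g al be].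
Proof.
case=> -[al [be [al01 be01 ->]]].
  by exists al, be; split=> //; [lra | rewrite /strip ifT //; lra].
by exists (al + 1), be; split=> //; [lra | rewrite strip_right ?addrK //; lra].
Qed.

Definition straight F0 phi0 (u : 'rV[R]_2) (gamma : R -> 'rV[R]_3) := forall t,
  exists F G psi (s : R), atlas_chart F0 phi0 F G psi /\ (s = 1 \/ s = -1) /\
    exists2 e, 0 < e & forall x, `|x - t| < e -> (F `|` G) (gamma x) /\
      psi (gamma x) = psi (gamma t) + (s * (x - t)) *: u.

Lemma trajectory_straight F0 phi0 u gamma :
  trajectory F0 phi0 u gamma -> straight F0 phi0 u gamma.
Proof.
move=> tr t; have [_ [F [G [psi [b [ch]]]]]] := tr t.
move=> /nbhs_ballP[e /= e0 H]; exists F, G, psi, ((-1) ^+ b); split=> //; split.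
  by case: b {H}; [right | left].
by exists e => // x; rewrite distrC => /H.
Qed.

Lemma straight_shift F0 phi0 u gamma T :
  straight F0 phi0 u gamma -> straight F0 phi0 u (fun x => gamma (x + T)).
Proof.
move=> st t; have [F [G [psi [s [ch [S [e e0 H]]]]]]] := st (t + T).
exists F, G, psi, s; split=> //; split=> //; exists e => // x xt.
by have := H (x + T); rewrite (_ : x + T - (t + T) = x - t); [apply | ring].
Qed.

Lemma straight_opp F0 phi0 u gamma :
  straight F0 phi0 u gamma -> straight F0 phi0 u (fun x => gamma (- x)).
Proof.
move=> st t; have [F [G [psi [s [ch [S [e e0 H]]]]]]] := st (- t).
exists F, G, psi, (- s); split=> //; split; first by case: S => ->; [right | left; rewrite opprK].
exists e => // x xt; have := H (- x); rewrite (_ : - x - - t = - (x - t)); last by ring.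
by rewrite normrN mulrN mulNr; apply.
Qed.

Definition strip_germ (v1 v2 : R) (gamma : R -> 'rV[R]_3) t :=
  exists g al be e, [/\ adapted g, 0 < e &
    forall x, `|x - t| < e -> [/\ 0 <= al + (x - t) * v1 <= 2, 0 <= be + (x - t) * v2 <= 1 &
      gamma x = strip g (al + (x - t) * v1) (be + (x - t) * v2)]].

(** The strip read backwards starts from its second square with e reversed, which changes the sign
    of [v1]. *)
Lemma strip_germ_normr1 v1 v2 gamma t :
  strip_germ v1 v2 gamma t -> strip_germ `|v1| v2 gamma t.
Proof.
have [_ //|_] := ger0P v1.
move=> [g [al [be [e [ad e0 H]]]]]; exists (flip_e *m (right *m g)), (2 - al), be, e; split=> //.
  exact/adapted_flip_e/adapted_right.
move=> x /H[h1 h2 ->]; rewrite strip_flip_e; split=> //; first by lra.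
by congr strip; ring.
Qed.

Lemma strip_germ_normr2 v1 v2 gamma t :
  strip_germ v1 v2 gamma t -> strip_germ v1 `|v2| gamma t.
Proof.
have [_ //|_] := ger0P v2.
move=> [g [al [be [e [ad e0 H]]]]]; exists (flip_f *m g), al, (1 - be), e; split=> //.
  exact/adapted_flip_f.
move=> x /H[h1 h2 ->]; rewrite strip_flip_f; split=> //; first by lra.
by congr strip; ring.
Qed.

(** The strip may lie along either axis of the chart, hence the alternative; all signs are absorbed
    by the choice of frame. *)
Lemma straight_strip_germ F0 phi0 u gamma t : unit_square_chart F0 phi0 ->
  straight F0 phi0 u gamma ->
  strip_germ `|u 0 0| `|u 0 1| gamma t \/ strip_germ `|u 0 1| `|u 0 0| gamma t.
Proof.
move=> h0 /(_ t)[F [G [psi [s [[unf tr] [S [e e0 H]]]]]]].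
have [g0 [ad0 EF0 ch]] := transported_chart h0 tr.
have [g [c [A [B [ad EF EG ax un]]]]] := unfolding_strip unf ad0 EF0 ch.
rewrite EF EG in H.
have [|gt _] := H t; first by rewrite subrr normr0.
have [al [be [al02 be01 Et]]] := strip_facets gt.
have key x : `|x - t| < e -> exists al' be', [/\ 0 <= al' <= 2, 0 <= be' <= 1,
    gamma x = strip g al' be' & forall m,
    al' * A 0 m + be' * B 0 m = al * A 0 m + be * B 0 m + s * (x - t) * u 0 m].
  move=> /H[gx]; have [al' [be' [al'02 be'01 Ex]]] := strip_facets gx.
  rewrite Et Ex !un // => E; exists al', be'; split=> // m.
  by have := congr1 (fun w : 'rV_2 => w 0 m) E; rewrite /= !mxE => {}E; lra.
have norm_s (a v : R) : a = 1 \/ a = -1 -> `|s * a * v| = `|v|.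
  by move=> S'; case: S => ->; case: S' => ->; rewrite ?mulrN ?mulNr ?opprK ?mul1r ?mulr1 ?normrN.
have [a [b [Sa Sb [[A0 A1 B0 B1]|[A0 A1 B0 B1]]]]] := axial_cases ax; [left | right].
- rewrite -(norm_s a) // -(norm_s b (u 0 1)) //; apply/strip_germ_normr1/strip_germ_normr2.
  exists g, al, be, e; split=> // x /key[al' [be' [al'02 be'01 -> E]]].
  have := E 0; have := E 1; rewrite A0 A1 B0 B1 => E1 E0.
  have <- : al' = al + (x - t) * (s * a * u 0 0).
    by case: Sa E0 => -> E0; lra.
  by have <- : be' = be + (x - t) * (s * b * u 0 1) by case: Sb E1 => -> E1; lra.
- rewrite -(norm_s a) // -(norm_s b (u 0 0)) //; apply/strip_germ_normr1/strip_germ_normr2.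
  exists g, al, be, e; split=> // x /key[al' [be' [al'02 be'01 -> E]]].
  have := E 0; have := E 1; rewrite A0 A1 B0 B1 => E1 E0.
  have <- : al' = al + (x - t) * (s * a * u 0 1).
    by case: Sa E1 => -> E1; lra.
  by have <- : be' = be + (x - t) * (s * b * u 0 0) by case: Sb E0 => -> E0; lra.
Qed.

End Transport.

(** * Trajectories are determined by their germs *)

Lemma real_induction (R : realType) (a : R) (P : R -> Prop) :
  (forall s, a <= s -> (forall x, a <= x < s -> P x) ->
    exists2 e, 0 < e & forall x, s <= x < s + e -> P x) ->
  forall s, a <= s -> P s.
Proof.
move=> step s0 as0; apply: contrapT => nPs0.
pose S := [set x | a <= x /\ forall y, a <= y < x -> P y].
have Sub : ubound S s0.
  move=> x [_ h]; rewrite leNgt; apply/negP => s0x; apply: nPs0; apply: h.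
  by rewrite as0.
have Sa : S a by split=> // y h; lra.
have hS : has_sup S by split; [exists a | exists s0].
have am : a <= sup S by apply: sup_upper_bound.
have [|e e0 he] := step (sup S) am.
  move=> x /andP[ax xm]; have [y [_ hy] xy] := sup_adherent (ltac:(lra) : 0 < sup S - x) hS.
  by apply: hy; rewrite ax; lra.
have : S (sup S + e).
  split=> [|y /andP[ay yme]]; first by lra.
  have [my|ym] := leP (sup S) y; first by apply: he; rewrite my.
  have [z [_ hz] yz] := sup_adherent (ltac:(lra) : 0 < sup S - y) hS.
  by apply: hz; rewrite ay; lra.
by move/(sup_upper_bound hS); lra.
Qed.

Lemma signed_neq (R : realType) (U V : R) (s t : int) : 0 < U -> 0 < V -> U != V ->
  sign s -> sign t -> U * s%:~R <> V * t%:~R.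
Proof.
move=> U0 V0 /eqP UV [->|->] [->|->]; rewrite ?mulr1z ?mulrN1z ?mulr1 ?mulrN1 => h;
  [apply: UV | | | apply: UV]; lra.
Qed.

Lemma signed_neq0 (R : realType) (U : R) (s : int) : 0 < U -> sign s -> U * s%:~R <> 0.
Proof. by move=> U0 [->|->]; rewrite ?mulr1z ?mulrN1z ?mulr1 ?mulrN1; lra. Qed.

Lemma coord_inj (R : realType) (m n s : int) (x y : R) : sign s ->
  0 < x <= 1 -> 0 < y <= 1 ->
  1 + m%:~R + (x - 2^-1) * s%:~R = 1 + n%:~R + (y - 2^-1) * s%:~R -> m = n /\ x = y.
Proof.
move=> S x01 y01 E; have mn : m = n.
  have : (m < n + 1) && (n < m + 1).
    by rewrite -!(ltr_int R) !intrD; case: S E => -> E; lra.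
  lia.
by split=> //; rewrite mn in E; case: S E => -> E; lra.
Qed.

(** A lattice plane separates two layers of cubes, and the parity of the index tells them apart. *)
Lemma normal_inj (R : realType) (v m n s t : int) : sign s -> sign t ->
  (2 %| v - m)%Z -> (2 %| v - n)%Z ->
  1 + m%:~R - s%:~R / 2 = 1 + n%:~R - t%:~R / 2 :> R -> m = n /\ s = t.
Proof.
move=> S T vm vn E; have : 2 * m - s = 2 * n - t.
  by apply: (@intr_inj R); rewrite !rmorphB /= !rmorphM /=; lra.
by case: S => ->; case: T => ->; lia.
Qed.

Section Flow.
Variable R : realType.
Implicit Types (g : 'M[int]_(4, 3)) (al be t x : R) (gamma : R -> 'rV[R]_3).

(** Room on both sides of t makes the point interior to the strip; on the middle edge it is
    attributed to the square it comes from. *)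
Lemma strip_germ_pos (v1 v2 : R) gamma t : 0 < v1 -> 0 < v2 ->
  strip_germ v1 v2 gamma t -> exists g al be e,
  [/\ adapted g, 0 < e, 0 < al <= 1 & 0 < be < 1] /\
  (forall x, t - e < x <= t -> gamma x = pos g (al + (x - t) * v1) (be + (x - t) * v2)) /\
  (forall x, t <= x < t + e -> gamma x =
     if al == 1 then pos (right *m g) ((x - t) * v1) (be + (x - t) * v2)
     else pos g (al + (x - t) * v1) (be + (x - t) * v2)).
Proof.
move=> v10 v20 [g [al [be [e [ad e0 H]]]]].
have [|/andP[l1 _] /andP[l2 _] _] := H (t - e / 2).
  by rewrite addrAC subrr add0r normrN gtr0_norm; lra.
have [|/andP[_ r1] /andP[_ r2] _] := H (t + e / 2).
  by rewrite addrAC subrr add0r gtr0_norm; lra.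
rewrite addrAC subrr add0r in l1 l2 r1 r2.
have ev1 : 0 < e / 2 * v1 by rewrite !mulr_gt0.
have ev2 : 0 < e / 2 * v2 by rewrite !mulr_gt0.
have near x : t - e < x < t + e -> `|x - t| < e by rewrite ltr_norml; lra.
have near1 d x : - d <= x - t <= d -> - (d * v1) <= (x - t) * v1 <= d * v1.
  by move=> /andP[h1 h2]; rewrite -mulNr !ler_pM2r // h1.
have [al1|al1|al1] := ltgtP al 1.
- pose d := Num.min e ((1 - al) / v1).
  have d0 : 0 < d by rewrite lt_min e0 divr_gt0 //; lra.
  have de : d <= e by rewrite ge_min lexx.
  have dv : d * v1 <= 1 - al by rewrite -ler_pdivlMr // ge_min lexx orbT.
  exists g, al, be, d; split; first by split=> //; lra.
  by split=> x xt; (have /near/H[_ _ ->] : t - e < x < t + e by lra);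
    (have /near1 h : - d <= x - t <= d by lra); rewrite ?lt_eqF // /strip ifT //; lra.
- pose d := Num.min e ((al - 1) / v1).
  have d0 : 0 < d by rewrite lt_min e0 divr_gt0 //; lra.
  have de : d <= e by rewrite ge_min lexx.
  have dv : d * v1 <= al - 1 by rewrite -ler_pdivlMr // ge_min lexx orbT.
  exists (right *m g), (al - 1), be, d.
  split; first by split; [exact: adapted_right | lra | lra | lra].
  have al2 : al - 1 < 1 by lra.
  split=> x xt; (have /near/H[_ _ ->] : t - e < x < t + e by lra);
    (have /near1 h : - d <= x - t <= d by lra); (rewrite ?(lt_eqF al2) strip_right; [congr pos; ring | lra]).
- subst al; exists g, 1, be, e; split; first by split=> //; lra.
  split=> x xt; (have /near/H[_ _ ->] : t - e < x < t + e by lra).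
    by rewrite /strip ifT // gerDl; apply: mulr_le0_ge0; lra.
  rewrite eqxx strip_right; first by congr pos; ring.
  by rewrite lerDl; apply: mulr_ge0; lra.
Qed.

End Flow.

Section Flow.
Variable R : realType.
Implicit Types (g : 'M[int]_(4, 3)) (al be t x : R) (gamma : R -> 'rV[R]_3).

Variables U1 U2 : R.
Hypothesis U1_gt0 : 0 < U1.
Hypothesis U2_gt0 : 0 < U2.
Hypothesis U1_neq_U2 : U1 != U2.

Definition gliding gamma := forall t, strip_germ U1 U2 gamma t \/ strip_germ U2 U1 gamma t.

Definition place := ('M[int]_(4, 3) * (R * R))%type.

Definition glide (z : place) x := pos z.1 (z.2.1 + x * U1) (z.2.2 + x * U2).

Definition cross (z : place) : place :=
  if z.2.1 == 1 then (right *m z.1, (0, z.2.2)) else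
  if z.2.2 == 1 then (up *m z.1, (z.2.1, 0)) else z.

(** The ranges are half-open, here and in [leaving]: a point of an edge ends the path in one square
    and begins it in the next. *)
Definition arriving gamma t (z : place) :=
  [/\ adapted z.1, 0 < z.2.1 <= 1, 0 < z.2.2 <= 1 &
   exists2 e, 0 < e & forall x, t - e < x <= t -> gamma x = glide z (x - t)].

Definition leaving gamma t (z : place) :=
  [/\ adapted z.1, 0 <= z.2.1 < 1, 0 <= z.2.2 < 1 &
   exists2 e, 0 < e & forall x, t <= x < t + e -> gamma x = glide z (x - t)].

(** The last bound says that the trajectory does not run into the corner (1, 1): a strip germ stays
    off the long sides of its strip. *)
Lemma gliding_cross gamma t : gliding gamma ->
  exists z, [/\ arriving gamma t z, leaving gamma t (cross z) & z.2.1 + z.2.2 < 2].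
Proof.
move=> /(_ t)[] /strip_germ_pos[] // g [al [be [e [[ad e0 al01 be01] [L Rt]]]]].
- exists (g, (al, be)); split=> /=; [by split=> //=; [lra | exists e] | | lra].
  rewrite /cross /=; have [al1|al1] := eqVneq al 1.
    split=> //=; [exact: adapted_right | lra | lra | exists e => // x /Rt ->].
    by rewrite al1 eqxx /glide /= add0r.
  rewrite lt_eqF; last by lra.
  split=> //=; [rewrite lt_neqAle al1; lra | lra | exists e => // x /Rt ->].
  by rewrite (negbTE al1).
- exists (swap *m g, (be, al)); split=> /=; last by lra.
    split=> //=; [exact: adapted_swap | lra | exists e => // x /L ->].
    by rewrite /glide /= pos_swap.
  rewrite /cross /= lt_eqF; last by lra.
  have [al1|al1] := eqVneq al 1.
    split=> /=; [by rewrite up_swap; exact/adapted_swap/adapted_right | lra | lra |].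
    by exists e => // x /Rt ->; rewrite al1 eqxx /glide /= up_swap pos_swap add0r.
  split=> //=; [exact: adapted_swap | lra | rewrite lt_neqAle al1; lra |].
  by exists e => // x /Rt ->; rewrite (negbTE al1) /glide /= pos_swap.
Qed.

Lemma direction_framed i j k s1 s2 s3 g l (d := U1 * (g row_e l)%:~R + U2 * (g row_f l)%:~R) :
  framed i j k s1 s2 s3 g ->
  [/\ l = i -> d = U1 * s1%:~R, l = j -> d = U2 * s2%:~R & l = k -> d = 0].
Proof.
move=> [[ij ik jk] _ rows _ _]; rewrite /d.
have [-> -> _] := rows l; split=> ->.
- by rewrite eqxx (negbTE ij) mulr0 addr0.
- by rewrite eqxx eq_sym (negbTE ij) mulr0 add0r.
- by rewrite ![k == _]eq_sym (negbTE ik) (negbTE jk) !mulr0 addr0.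
Qed.

Lemma framed_direction_inj i j k s1 s2 s3 g i' j' k' s1' s2' s3' g' :
  framed i j k s1 s2 s3 g -> framed i' j' k' s1' s2' s3' g' ->
  (forall l, U1 * (g row_e l)%:~R + U2 * (g row_f l)%:~R =
             U1 * (g' row_e l)%:~R + U2 * (g' row_f l)%:~R) ->
  [/\ i = i', j = j', k = k', s1 = s1' & s2 = s2'].
Proof.
move=> fr fr' E; have [[ij ik jk] [S1 S2 _] _ _ _] := fr.
have [_ [S1' S2' _] _ _ _] := fr'.
have U12 (s t : int) : sign s -> sign t -> _ := signed_neq U1_gt0 U2_gt0 U1_neq_U2.
have [ii sE1] : i = i' /\ s1 = s1'.
  have := E i; have [/(_ erefl) -> _ _] := direction_framed i fr.
  have [d1 d2 d3] := direction_framed i fr'.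
  have [ii|ij'|ik'] := axes_cases i (fr_axes fr').
  - rewrite (d1 ii); split=> //; apply: (@intr_inj R).
    by apply: (mulfI (lt0r_neq0 U1_gt0)).
  - by rewrite (d2 ij') => /(U12 _ _ S1 S2').
  - by rewrite (d3 ik') => /(signed_neq0 U1_gt0 S1).
have [jj sE2] : j = j' /\ s2 = s2'.
  have := E j; have [_ /(_ erefl) -> _] := direction_framed j fr.
  have [d1 d2 d3] := direction_framed j fr'.
  have [ji'|jj|jk'] := axes_cases j (fr_axes fr').
  - by rewrite (d1 ji') => /esym/(U12 _ _ S1' S2).
  - rewrite (d2 jj); split=> //; apply: (@intr_inj R).
    by apply: (mulfI (lt0r_neq0 U2_gt0)).
  - by rewrite (d3 jk') => /(signed_neq0 U2_gt0 S2).
split=> //; have [ki|kj|//] := axes_cases k (fr_axes fr').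
- by rewrite ki -ii eqxx in ik.
- by rewrite kj -jj eqxx in jk.
Qed.

(** The germ gives the point and the velocity U1 e + U2 f. As U1 and U2 differ, the velocity reveals
    e and f; the point and the parity of the cube then give n, w and the coordinates. *)
Lemma arriving_inj gamma gamma' t z z' : arriving gamma t z -> arriving gamma' t z' ->
  (exists2 e, 0 < e & forall x, t - e < x < t -> gamma x = gamma' x) -> z = z'.
Proof.
case: z z' => [g [al be]] [g' [al' be']].
move=> [/= [i [j [k [s1 [s2 [s3 fr]]]]]] al01 be01 [e e0 H]].
move=> [/= [i' [j' [k' [s1' [s2' [s3' fr']]]]]] al'01 be'01 [e' e'0 H']] [e'' e''0 agree].
pose d := Num.min e (Num.min e' e'').
have d0 : 0 < d by rewrite !lt_min e0 e'0.
have [de de' de''] : [/\ d <= e, d <= e' & d <= e''].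
  by rewrite !ge_min !lexx !orbT.
pose D (g : 'M[int]_(4, 3)) l := U1 * (g row_e l)%:~R + U2 * (g row_f l)%:~R.
have glideE g0 a b h l : pos g0 (a + (t - h - t) * U1) (b + (t - h - t) * U2) 0 l =
    pos g0 a b 0 l - h * D g0 l by rewrite !mxE /D; ring.
have E h l : 0 < h < d -> pos g al be 0 l - h * D g l = pos g' al' be' 0 l - h * D g' l.
  move=> hd; have := agree (t - h); rewrite H ?H'; [|lra|lra].
  by move=> /(_ (ltac:(lra))) /(congr1 (fun p : 'rV_3 => p 0 l)); rewrite !glideE.
have solve (x y x' y' h : R) : 0 < h -> x - h / 2 * y = x' - h / 2 * y' ->
    x - h / 4 * y = x' - h / 4 * y' -> x = x' /\ y = y'.
  by clear=> h0 h1 h2; split; [lra | apply: (mulfI (lt0r_neq0 h0)); lra].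
have DP l : pos g al be 0 l = pos g' al' be' 0 l /\ D g l = D g' l.
  by apply: (solve _ _ _ _ d) => //; apply: E; lra.
have [l|ii jj kk ss1 ss2] := framed_direction_inj fr fr'.
  by have [] := DP l.
subst i' j' k' s1' s2'.
have P l := (DP l).1.
have [Pi Pj Pk] := pos_framed al be fr; have [Pi' Pj' Pk'] := pos_framed al' be' fr'.
have [ax [S1 S2 S3] rows ev od] := fr; have [_ [_ _ S3'] rows' ev' od'] := fr'.
have [wi al_eq] : g row_w i = g' row_w i /\ al = al'.
  exact: coord_inj S1 al01 al'01 (etrans (esym Pi) (etrans (P i) Pi')).
have [wj be_eq] : g row_w j = g' row_w j /\ be = be'.
  exact: coord_inj S2 be01 be'01 (etrans (esym Pj) (etrans (P j) Pj')).
have [wk ss3] : g row_w k = g' row_w k /\ s3 = s3'.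
  rewrite -wi in ev'.
  exact: normal_inj S3 S3' ev ev' (etrans (esym Pk) (etrans (P k) Pk')).
congr (_, (_, _)) => //; apply/matrixP => x l.
have [e1 e2 e3] := rows l; have [e1' e2' e3'] := rows' l.
case: x => [[|[|[|[|//]]]] h].
- by move: e1 e1'; rewrite (_ : Ordinal h = row_e) => [-> ->|]; last exact: val_inj.
- by move: e2 e2'; rewrite (_ : Ordinal h = row_f) => [-> ->|]; last exact: val_inj.
- by move: e3 e3'; rewrite (_ : Ordinal h = row_n) => [-> ->|]; [rewrite ss3|exact: val_inj].
- rewrite (_ : Ordinal h = row_w); last exact: val_inj.
  by have [->|->|->] := axes_cases l ax.
Qed.

(** The past germ at an instant fixes the arriving place, and [cross] computes from it the germ that
    follows. *)
Lemma gliding_unique gamma gamma' a b : gliding gamma -> gliding gamma' -> a < b ->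
  (forall x, a <= x < b -> gamma x = gamma' x) -> forall x, a <= x -> gamma x = gamma' x.
Proof.
move=> gl gl' ab agree; apply: real_induction => s as_ before.
have [sb|bs] := ltP s b.
  by exists (b - s) => [|x xs]; [lra | apply: agree; lra].
have [z [arr lv _]] := gliding_cross s gl; have [z' [arr' lv' _]] := gliding_cross s gl'.
have zz : z = z'.
  apply: arriving_inj arr arr' _; exists (s - a) => [|x xs]; first by lra.
  by apply: before; lra.
have [_ _ _ [e e0 H]] := lv; have [_ _ _ [e' e'0 H']] := lv'.
exists (Num.min e e') => [|x xs]; first by rewrite lt_min e0.
have [me me'] : Num.min e e' <= e /\ Num.min e e' <= e' by rewrite !ge_min !lexx orbT.
by rewrite H ?H' ?zz //; lra.
Qed.

(** Germs give only local information; real induction patches them, comparing at each instant the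
    arriving place of the trajectory with that of the ray inside the square. *)
Lemma leaving_glide gamma t z T : gliding gamma -> leaving gamma t z -> 0 < T ->
  z.2.1 + T * U1 <= 1 -> z.2.2 + T * U2 <= 1 ->
  leaving gamma (t + T) (cross (z.1, (z.2.1 + T * U1, z.2.2 + T * U2))) /\
  z.2.1 + T * U1 + (z.2.2 + T * U2) < 2.
Proof.
move=> gl [ad z1 z2 [e e0 H]] T0 T1 T2.
have mono (s U : R) : 0 < U -> 0 < s <= T -> 0 < s * U <= T * U.
  by move=> U0 sT; rewrite mulr_gt0 ?ler_pM2r //; lra.
pose y s : place := (z.1, (z.2.1 + (s - t) * U1, z.2.2 + (s - t) * U2)).
have glide_y s x : glide (y s) (x - s) = glide z (x - t).
  by rewrite /glide /=; congr pos; ring.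
have reach s : 0 < s - t <= T -> (forall x, t <= x < s -> gamma x = glide z (x - t)) ->
    [/\ gamma s = glide z (s - t), leaving gamma s (cross (y s)) &
        (y s).2.1 + (y s).2.2 < 2].
  move=> sT before; have [z0 [arr lv sum]] := gliding_cross s gl.
  have arr_y : arriving (fun x => glide z (x - t)) s (y s).
    have m1 := mono _ _ U1_gt0 sT; have m2 := mono _ _ U2_gt0 sT.
    split=> //=; [lra | lra | exists 1 => // x _; by rewrite glide_y].
  have zy : z0 = y s.
    apply: arriving_inj arr arr_y _; exists (s - t) => [|x xs]; first by lra.
    by apply: before; lra.
  rewrite zy in arr lv sum; split=> //; have [_ _ _ [e1 e10 ->]] := arr; last by lra.
  exact: glide_y.
have on_ray s : t <= s -> s <= t + T -> gamma s = glide z (s - t).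
  move: s; apply: (@real_induction R t (fun s => s <= t + T -> gamma s = glide z (s - t))) => s ts before.
  have [st|{}ts] := leP s t.
    by exists e => // x xs _; apply: H; lra.
  have [sT|Ts] := ltP (t + T) s; first by exists 1 => // x xs xT; exfalso; lra.
  have [||gs lv _] := reach s; [lra | by move=> x xs; apply: before; lra |].
  have [sT|sT] := eqVneq s (t + T).
    by exists 1 => // x xs xT; have -> : x = s by lra.
  have {}sT : s < t + T by rewrite lt_neqAle sT.
  have h1 : (s - t) * U1 < T * U1 by rewrite ltr_pM2r //; lra.
  have h2 : (s - t) * U2 < T * U2 by rewrite ltr_pM2r //; lra.
  have yE : cross (y s) = y s by rewrite /cross /= !lt_eqF //; lra.
  have [_ _ _ [e1 e10 H1]] := lv; rewrite yE in H1.
  by exists e1 => // x xs _; rewrite H1 // glide_y.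
have [||_ lv sum] := reach (t + T); [lra | by move=> x xs; apply: on_ray; lra |].
by move: lv sum; rewrite /y (addrC t) addrK.
Qed.

(* Constant along the lines of slope [p / q] in a square; such a line leaves the
   square through the right edge when its offset is below [q]. *)
Definition offset (q p : R) (z : place) := q * z.2.2 + p * (1 - z.2.1).

Lemma leaving_step q p gamma t z : 0 < q -> 0 < p -> U2 * q = U1 * p ->
  gliding gamma -> leaving gamma t z ->
  exists t' z', [/\ t < t', leaving gamma t' z', z'.2.1 = 0 \/ z'.2.2 = 0 &
    (offset q p z', z'.1) = cut_step q p (mulmx right) (mulmx up) (offset q p z, z.1)].
Proof.
move=> q0 p0 slope gl lv; have [ad z1 z2 _] := lv.
rewrite /cut_step /offset /=; case: ltP => h.
- pose T := (1 - z.2.1) / U1.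
  have T1 : T * U1 = 1 - z.2.1 by rewrite divfK // lt0r_neq0.
  have T2 : T * U2 * q = (1 - z.2.1) * p by rewrite -mulrA slope mulrA T1.
  have T2lt : z.2.2 + T * U2 < 1 by rewrite -(ltr_pM2r q0) mulrDl T2; lra.
  have [|||lv' _] := leaving_glide gl lv (T := T).
  + by rewrite divr_gt0 //; lra.
  + by rewrite T1; lra.
  + exact: ltW.
  rewrite /cross /= T1 [z.2.1 + (1 - _)]addrC subrK eqxx in lv'.
  exists (t + T), (right *m z.1, (0, z.2.2 + T * U2)); split=> //=.
  + by rewrite ltrDl divr_gt0 //; lra.
  + by left.
  + by congr pair; rewrite mulrDr [q * (T * U2)]mulrC T2; ring.
- pose T := (1 - z.2.2) / U2.
  have T2 : T * U2 = 1 - z.2.2 by rewrite divfK // lt0r_neq0.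
  have T1 : T * U1 * p = (1 - z.2.2) * q by rewrite -mulrA -slope mulrA T2.
  (* Equality would send the line into the corner; [sum] below excludes it. *)
  have T1le : z.2.1 + T * U1 <= 1 by rewrite -(ler_pM2r p0) mulrDl T1; lra.
  have [|||lv' sum] := leaving_glide gl lv (T := T).
  + by rewrite divr_gt0 //; lra.
  + exact: T1le.
  + by rewrite T2; lra.
  rewrite /cross /= T2 [z.2.2 + (1 - _)]addrC subrK eqxx lt_eqF in lv'; last first.
    by rewrite T2 in sum; lra.
  exists (t + T), (up *m z.1, (z.2.1 + T * U1, 0)); split=> //=.
  + by rewrite ltrDl divr_gt0 //; lra.
  + by right.
  + congr pair; transitivity (p * (1 - z.2.1) - T * U1 * p); [by ring | by rewrite T1; ring].
Qed.

End Flow.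

(** * From periodic codings to closed trajectories and dense directions *)

Section Conclusion.
Variable R : realType.
Implicit Types (g : 'M[int]_(4, 3)) (t x : R) (gamma : R -> 'rV[R]_3).

Lemma leaving_iter (U1 U2 q p : R) gamma t z n :
  0 < U1 -> 0 < U2 -> U1 != U2 -> 0 < q -> 0 < p -> U2 * q = U1 * p ->
  gliding U1 U2 gamma -> leaving U1 U2 gamma t z ->
  exists t' z', [/\ t < t', leaving U1 U2 gamma t' z', z'.2.1 = 0 \/ z'.2.2 = 0 &
    (offset q p z', z'.1) =
      iter n.+1 (cut_step q p (mulmx right) (mulmx up)) (offset q p z, z.1)].
Proof.
move=> U10 U20 U12 q0 p0 slope gl; elim: n => [|n IH] lv; first exact: leaving_step.
have [t1 [z1 [tt1 lv1 _ E1]]] := IH lv.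
have [t2 [z2 [tt2 lv2 h E2]]] := leaving_step U10 U20 U12 q0 p0 slope gl lv1.
by exists t2, z2; split; rewrite ?(lt_trans tt1) // E2 E1.
Qed.

(** On the left and lower edges the offset minus p is q b or - p a, so its sign tells the edge and
    its value the point. *)
Lemma offset_inj (q p : R) (z z' : place R) : 0 < q -> 0 < p ->
  0 <= z.2.1 < 1 -> 0 <= z.2.2 < 1 -> 0 <= z'.2.1 < 1 -> 0 <= z'.2.2 < 1 ->
  z.2.1 = 0 \/ z.2.2 = 0 -> z'.2.1 = 0 \/ z'.2.2 = 0 ->
  (offset q p z, z.1) = (offset q p z', z'.1) -> z = z'.
Proof.
case: z z' => [g [a b]] [g' [a' b']] /= q0 p0 ha hb ha' hb' e e' [E ->].
suff [-> ->] : a = a' /\ b = b' by [].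
have nneg (s y : R) : 0 < s -> 0 <= y < 1 -> 0 <= s * y /\ (s * y = 0 -> y = 0).
  move=> s0 /andP[y0 _]; split; first by rewrite mulr_ge0 // ltW.
  by move/eqP; rewrite mulf_eq0 gt_eqF //= => /eqP.
have [n1 i1] := nneg _ _ p0 ha; have [n2 i2] := nneg _ _ q0 hb.
have [n3 i3] := nneg _ _ p0 ha'; have [n4 i4] := nneg _ _ q0 hb'.
move: E; rewrite /offset /= => E.
have {}E : q * b - p * a = q * b' - p * a' by move: E; clear; lra.
have opp0 (v w : R) : 0 <= v -> 0 <= w -> v = - w -> v = 0 /\ w = 0 by clear; lra.
move: i1 i2 i3 i4 E n1 n2 n3 n4; case: e => ->; case: e' => ->; rewrite ?mulr0 ?subr0 ?sub0r.
- by move=> _ _ _ _ /(mulfI (lt0r_neq0 q0)) ->.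
- by move=> _ i2 i3 _ E _ n2 n3 _; have [/i2 -> /i3 ->] := opp0 _ _ n2 n3 E.
- by move=> i1 _ _ i4 E n1 _ _ n4; have [/i4 -> /i1 ->] := opp0 _ _ n4 n1 (esym E).
- by move=> _ _ _ _ /oppr_inj/(mulfI (lt0r_neq0 p0)) ->.
Qed.

Lemma straight_gliding F0 phi0 (u : 'rV[R]_2) gamma : unit_square_chart F0 phi0 ->
  straight F0 phi0 u gamma -> gliding `|u 0 0| `|u 0 1| gamma.
Proof. by move=> h0 st t; exact: straight_strip_germ h0 st. Qed.

Lemma straight_closed F0 phi0 (u : 'rV[R]_2) (q p : R) gamma : unit_square_chart F0 phi0 ->
  u 0 0 != 0 -> u 0 1 != 0 -> `|u 0 0| != `|u 0 1| -> 0 < q -> 0 < p ->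
  `|u 0 1| * q = `|u 0 0| * p ->
  eventually_periodic q p (@mulmx int 4 4 3 right) (mulmx up) ->
  straight F0 phi0 u gamma -> closed_trajectory gamma.
Proof.
move=> h0; rewrite -(normr_gt0 (u 0 0)) -(normr_gt0 (u 0 1)) => U10 U20 U12 q0 p0 slope per st.
have gl := straight_gliding h0 st.
have [z [_ lv _]] := gliding_cross U10 U20 0 gl.
have [|m [n E]] := per (offset q p (cross z), (cross z).1).
  have [_ c1 c2 _] := lv; rewrite /offset /=.
  have h1 : 0 <= q * (cross z).2.2 < q by apply/andP; split; [apply: mulr_ge0; lra | rewrite gtr_pMr //; lra].
  have h2 : 0 < p * (1 - (cross z).2.1) <= p by apply/andP; split; [apply: mulr_gt0; lra | rewrite ger_pMr //; lra].
  by move: h1 h2; clear; lra.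
(* The starting place may be inside a square; taking [m.+1] steps instead of [m] puts both places on
   entry edges, as [offset_inj] demands. *)
have [t1 [z1 [_ lv1 e1 E1]]] := leaving_iter m U10 U20 U12 q0 p0 slope gl lv.
have [t2 [z2 [t12 lv2 e2 E2]]] := leaving_iter n U10 U20 U12 q0 p0 slope gl lv1.
have zz : z2 = z1.
  have [_ a1 b1 _] := lv1; have [_ a2 b2 _] := lv2.
  apply: (offset_inj q0 p0) => //.
  by rewrite E2 E1 -iterD addnC addSn iterS E.
pose T := t2 - t1; have T0 : 0 < T by rewrite subr_gt0.
have stT := straight_shift T st.
have [_ _ _ [d1 d10 H1]] := lv1; have [_ _ _ [d2 d20 H2]] := lv2.
have forward x : t1 <= x -> gamma x = gamma (x + T).
  apply: (gliding_unique U10 U20 U12 gl (straight_gliding h0 stT) (b := t1 + Num.min d1 d2)).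
    by rewrite ltrDl lt_min d10.
  have [m1 m2] : Num.min d1 d2 <= d1 /\ Num.min d1 d2 <= d2 by rewrite !ge_min !lexx orbT.
  move=> y yt; rewrite H1; last by lra.
  rewrite H2 ?zz; last by rewrite /T; lra.
  by congr glide; rewrite /T; ring.
exists T => // t; apply/esym.
have [t1t|tt1] := leP t1 t; first exact: forward.
(* Before [t1], uniqueness is applied to the reversed trajectories, which agree on [- t1 - 1, - t1)
   by the forward case. *)
rewrite -[t]opprK.
apply: (gliding_unique U10 U20 U12 (straight_gliding h0 (straight_opp st))
  (straight_gliding h0 (straight_opp stT)) (a := - t1 - 1) (b := - t1)); try lra.
by move=> x xt; apply: forward; lra.
Qed.

Lemma normalize_close (v V N d : R) : 0 <= v <= 1 -> v <= V <= v + d ->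
  1 <= N <= 1 + 2 * d -> `|v - V / N| <= 2 * d.
Proof.
move=> v01 /andP[vV Vd] /andP[N1 Nd]; have N0 : 0 < N by lra.
have h1 : V / N <= V by rewrite ler_pdivrMr // ler_peMr //; lra.
have h2 : v - (N - 1) <= V / N.
  rewrite ler_pdivlMr // (le_trans _ vV) //.
  by have : 0 <= (N - 1) * (N - v) by [apply: mulr_ge0; lra]; lra.
by rewrite ler_norml; lra.
Qed.

Lemma norm_close (x y X Y N d : R) : 0 <= x <= 1 -> 0 <= y <= 1 -> x ^+ 2 + y ^+ 2 = 1 ->
  x <= X <= x + d -> y <= Y <= y + d -> 0 <= N -> N ^+ 2 = X ^+ 2 + Y ^+ 2 ->
  1 <= N <= 1 + 2 * d.
Proof.
move=> x01 y01 xy Xd Yd N0 N2.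
have lower : x ^+ 2 + y ^+ 2 <= X ^+ 2 + Y ^+ 2.
  by apply: lerD; rewrite ler_sqr ?nnegrE; lra.
have upper : X ^+ 2 + Y ^+ 2 <= (x + d) ^+ 2 + (y + d) ^+ 2.
  by apply: lerD; rewrite ler_sqr ?nnegrE; lra.
have hx : 0 <= d * (1 - x) by apply: mulr_ge0; lra.
have hy : 0 <= d * (1 - y) by apply: mulr_ge0; lra.
have hd : 0 <= d ^+ 2 by exact: sqr_ge0.
by apply/andP; split; rewrite -ler_sqr ?nnegrE //; lra.
Qed.

End Conclusion.

Theorem theorem1p4 (R : realType) (F0 : set 'rV[R]_3)
    (phi0 : 'rV[R]_3 -> 'rV[R]_2) (hphi0 : unit_square_chart F0 phi0) :
  @circle R `<=` closure (periodic_directions F0 phi0).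
Proof.
move=> u u1 B /nbhs_ballP[e /= e0 ballB].
have {u1} u1 : `|u 0 0| ^+ 2 + `|u 0 1| ^+ 2 = 1 :> R.
  by rewrite !real_normK ?num_real // -enorm2_row2 u1 expr1n.
have le1 (v w : R) : 0 <= v -> v ^+ 2 + w ^+ 2 = 1 -> 0 <= v <= 1 by clear=> *; nra.
have x01 := le1 _ _ (normr_ge0 (u 0 0)) u1.
have y01 : 0 <= `|u 0 1| <= 1 by apply: (le1 _ `|u 0 0|) => //; rewrite addrC.
pose d := e / 3; have d0 : 0 < d by rewrite divr_gt0.
(* Enlarging the coordinates keeps the approximating slope positive and finite even when [u] lies on
   an axis. *)
pose X := `|u 0 0| + d; have X0 : 0 < X by rewrite /X; lra.
pose a := (`|u 0 1| + d / 2) / X; pose b := (`|u 0 1| + d) / X.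
have a0 : 0 < a by rewrite divr_gt0 //; lra.
have ab : a < b by rewrite ltr_pM2r ?invr_gt0 //; lra.
(* The window of slopes is shrunk so as to miss 1, where the two speeds would coincide. *)
have [c [ac cb c1]] : exists c, [/\ a < c, c <= b & forall s, a < s < c -> s != 1].
  have [a1|a1] := ltP a 1; last by exists b; split=> // s /andP[sa _]; rewrite gt_eqF //; lra.
  exists (Num.min b 1); split; [by rewrite lt_min ab | by rewrite ge_min lexx |].
  by move=> s /andP[_]; rewrite lt_min => /andP[_ s1]; rewrite lt_eqF.
have [w [w4 q0 p0 /andP[aw wc]]] := tame_slope_dense a0 ac.
have per := @eventually_periodic_word R 3 w (right, up) w4.
set q := (slope w).1%:R in aw wc per; set p := (slope w).2%:R in aw wc per.
have {}q0 : 0 < q by rewrite ltr0n.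
have {}p0 : 0 < p by rewrite ltr0n.
have pq1 : p / q != 1 by apply: c1; rewrite aw.
pose Y := X * (p / q); pose N := Num.sqrt (X ^+ 2 + Y ^+ 2).
have Y0 : 0 < Y by rewrite mulr_gt0 // divr_gt0.
have Yb : `|u 0 1| + d / 2 < Y < `|u 0 1| + d.
  rewrite /Y [X * _]mulrC -(ltr_pdivrMr _ _ X0) -(ltr_pdivlMr _ _ X0) aw; exact: lt_le_trans wc cb.
have N2 : N ^+ 2 = X ^+ 2 + Y ^+ 2 by rewrite sqr_sqrtr // addr_ge0 // sqr_ge0.
have N0 : 0 < N by rewrite sqrtr_gt0 addr_gt0 // exprn_gt0.
have N1 : 1 <= N <= 1 + 2 * d.
  by apply: (norm_close x01 y01 u1 _ _ (ltW N0) N2); [rewrite /X | ]; lra.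
(* The value 1 at 0 keeps both coordinates of [u'] nonzero. *)
pose sg (v : R) := if v < 0 then -1 else 1 : R.
have sgE v : v = sg v * `|v| by rewrite /sg; case: ltP => h; [rewrite ltr0_norm // mulN1r opprK | rewrite ger0_norm // mul1r].
have sg_norm v z : `|sg v * z| = `|z|.
  by rewrite /sg; case: ifP; rewrite ?mulN1r ?normrN ?mul1r.
pose u' : 'rV[R]_2 := \row_m (if m == 0 then sg (u 0 0) * (X / N) else sg (u 0 1) * (Y / N)).
have u'0 : `|u' 0 0| = X / N by rewrite mxE /= sg_norm gtr0_norm // divr_gt0.
have u'1 : `|u' 0 1| = Y / N by rewrite mxE /= sg_norm gtr0_norm // divr_gt0.
exists u'; split.
  split.
    apply/eqP; rewrite -sqrp_eq1 ?sqrtr_ge0 // enorm2_row2.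
    rewrite -[u' 0 0 ^+ 2]real_normK ?num_real // -[u' 0 1 ^+ 2]real_normK ?num_real //.
    by rewrite u'0 u'1 !expr_div_n -mulrDl -N2 divff // expf_neq0 ?lt0r_neq0.
  move=> gamma /trajectory_straight; apply: (straight_closed (q := q) (p := p) hphi0) => //.
  - by rewrite -normr_gt0 u'0 divr_gt0.
  - by rewrite -normr_gt0 u'1 divr_gt0.
  - rewrite u'0 u'1 (inj_eq (mulIf _)) ?invr_neq0 ?lt0r_neq0 // eq_sym /Y.
    by rewrite -[X in _ != X]mulr1 (inj_eq (mulfI _)) // lt0r_neq0.
  - by rewrite u'0 u'1 /Y; field; rewrite !lt0r_neq0.
apply: ballB; split=> // i m; rewrite ord1 /ball /=.
have [->|->] : m = 0 \/ m = 1 by case: m => [[|[|//]] h]; [left | right]; exact: val_inj.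
- rewrite mxE /= {1}[u 0 0]sgE -mulrBr sg_norm.
  apply: (le_lt_trans (normalize_close (d := d) x01 _ N1)); rewrite /X /d; lra.
- rewrite mxE /= {1}[u 0 1]sgE -mulrBr sg_norm.
  apply: (le_lt_trans (normalize_close (d := d) y01 _ N1)); rewrite /d in Yb *; lra.
Qed.
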